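(* Let $p\ne 2$ be a prime integer and let $R=\mathbb F_p[x,y]/(y^2-x^3-x^2)$. Then (i) $\mathrm{gl.dim}(R^\infty)=3$, and (ii) $\mathrm{w.dim}(R^\infty)=2$.
   Context: For a ring $R$ of prime characteristic $p$ with Frobenius map $F(a)=a^p$, the perfect closure is $R^\infty=\varinjlim(R\xrightarrow{F}R\xrightarrow{F}\cdots)$. $\mathrm{gl.dim}$ is global dimension and $\mathrm{w.dim}$ is weak dimension (supremum of flat dimensions of all modules). *)

(* Defs.v *)
From HB Require Import structures.
From mathcomp Require Import all_boot all_order all_algebra.
From mathcomp Require Import boolp zify.

Set Implicit Arguments.
Unset Strict Implicit.
Unset Printing Implicit Defensive.

Import GRing.Theory.
Local Open Scope ring_scope.
Local Open Scope quotient_scope.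

Section Tensor.
Variables (A : comNzRingType) (M N : lmodType A).
Implicit Types s t u v : seq (M * N).

(* A list of pairs represents the sum of the corresponding pure tensors; two
   lists are identified modulo the congruence generated by bilinearity. *)
Inductive tensor_eq : seq (M * N) -> seq (M * N) -> Prop :=
| TensorRefl s : tensor_eq s s
| TensorSym s t : tensor_eq s t -> tensor_eq t s
| TensorTrans s t u : tensor_eq s t -> tensor_eq t u -> tensor_eq s u
| TensorCat s t u v :
    tensor_eq s t -> tensor_eq u v -> tensor_eq (s ++ u) (t ++ v)
| TensorComm s t : tensor_eq (s ++ t) (t ++ s)
| TensorZero n : tensor_eq [:: (0, n)] [::]
| TensorAddl m m' n : tensor_eq [:: (m + m', n)] [:: (m, n); (m', n)]
| TensorAddr m n n' : tensor_eq [:: (m, n + n')] [:: (m, n); (m, n')]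
| TensorScale a m n : tensor_eq [:: (a *: m, n)] [:: (m, a *: n)].

Definition tensor_rel s t : bool := `[< tensor_eq s t >].

Lemma tensor_relP s t : reflect (tensor_eq s t) (tensor_rel s t).
Proof. exact: asboolP. Qed.

Lemma tensor_rel_refl : reflexive tensor_rel.
Proof. by move=> s; apply/tensor_relP/TensorRefl. Qed.

Lemma tensor_rel_sym : symmetric tensor_rel.
Proof.
by move=> s t; apply/tensor_relP/tensor_relP => h; apply: TensorSym.
Qed.

Lemma tensor_rel_trans : transitive tensor_rel.
Proof.
move=> t s u /tensor_relP h1 /tensor_relP h2; apply/tensor_relP.
exact: TensorTrans h1 h2.
Qed.

Canonical tensor_equiv :=
  EquivRel tensor_rel tensor_rel_refl tensor_rel_sym tensor_rel_trans.

Definition tensor : Type := {eq_quot tensor_rel}.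
HB.instance Definition _ := Choice.on tensor.

Definition tensor_class s : tensor := \pi_{eq_quot tensor_rel} s.
Definition tensor_list (x : tensor) : seq (M * N) :=
  repr (x : {eq_quot tensor_rel}).

Lemma tensor_listK x : tensor_class (tensor_list x) = x.
Proof. exact: reprK. Qed.

Lemma tensorW (P : tensor -> Prop) :
  (forall s, P (tensor_class s)) -> forall x, P x.
Proof. by move=> h x; rewrite -(tensor_listK x). Qed.

Lemma tensor_classP s t : tensor_class s = tensor_class t <-> tensor_eq s t.
Proof.
split; first by move/eqquotP/tensor_relP.
by move=> h; apply/eqquotP/tensor_relP.
Qed.

Lemma tensor_listP s : tensor_eq (tensor_list (tensor_class s)) s.
Proof. by apply/tensor_classP; rewrite tensor_listK. Qed.

Definition tscale_seq (a : A) s := [seq (a *: x.1, x.2) | x <- s].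

Lemma tscale_seq_eq a s t :
  tensor_eq s t -> tensor_eq (tscale_seq a s) (tscale_seq a t).
Proof.
elim=> {s t}
  [s|s t _ h|s t u _ h _ h'|s t u v _ h _ h'|s t|n|m m' n|m n n'|b m n].
- exact: TensorRefl.
- exact: TensorSym.
- exact: TensorTrans h h'.
- by rewrite /tscale_seq !map_cat; apply: TensorCat.
- by rewrite /tscale_seq !map_cat; apply: TensorComm.
- by rewrite /= scaler0; apply: TensorZero.
- by rewrite /= scalerDr; apply: TensorAddl.
- exact: TensorAddr.
- by rewrite /= scalerA mulrC -scalerA; apply: TensorScale.
Qed.

Definition tzero : tensor := tensor_class [::].
Definition tadd (x y : tensor) : tensor :=
  tensor_class (tensor_list x ++ tensor_list y).
Definition tscale (a : A) (x : tensor) : tensor :=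
  tensor_class (tscale_seq a (tensor_list x)).
Definition topp (x : tensor) : tensor := tscale (-1) x.

Lemma tadd_pi s t : tadd (tensor_class s) (tensor_class t)
  = tensor_class (s ++ t).
Proof. by apply/tensor_classP/TensorCat; apply: tensor_listP. Qed.

Lemma tscale_pi a s : tscale a (tensor_class s) = tensor_class (tscale_seq a s).
Proof. by apply/tensor_classP/tscale_seq_eq/tensor_listP. Qed.

Lemma taddA : associative tadd.
Proof.
elim/tensorW=> s; elim/tensorW=> t; elim/tensorW=> u.
by rewrite (tadd_pi t) (tadd_pi s) (tadd_pi s) (tadd_pi (s ++ t)) catA.
Qed.

Lemma taddC : commutative tadd.
Proof.
elim/tensorW=> s; elim/tensorW=> t; rewrite (tadd_pi s) (tadd_pi t).
exact/tensor_classP/TensorComm.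
Qed.

Lemma tadd0 : left_id tzero tadd.
Proof. by elim/tensorW=> s; rewrite tadd_pi. Qed.

Lemma tscaleA a b x : tscale a (tscale b x) = tscale (a * b) x.
Proof.
elim/tensorW: x => s; rewrite (tscale_pi b) (tscale_pi a) (tscale_pi (a * b)).
rewrite /tscale_seq -map_comp.
by congr (tensor_class _); apply: eq_map => x /=; rewrite scalerA.
Qed.

Lemma tscale1 : left_id 1 tscale.
Proof.
elim/tensorW=> s; rewrite tscale_pi; congr (tensor_class _).
by rewrite -[RHS]map_id; apply: eq_map => -[m n] /=; rewrite scale1r.
Qed.

Lemma tscaleDr : right_distributive tscale tadd.
Proof.
move=> a; elim/tensorW=> s; elim/tensorW=> t.
rewrite (tadd_pi s) (tscale_pi a) (tscale_pi a s) (tscale_pi a t).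
by rewrite (tadd_pi (tscale_seq a s)) /tscale_seq map_cat.
Qed.

Lemma tscaleDl x : {morph tscale^~ x : a b / a + b >-> tadd a b}.
Proof.
move=> a b; elim/tensorW: x => s; rewrite (tscale_pi (a + b)).
rewrite (tscale_pi a) (tscale_pi b) (tadd_pi (tscale_seq a s)).
apply/tensor_classP; elim: s => [|[m n] s IHs] /=; first exact: TensorRefl.
rewrite scalerDl -cat1s.
apply: (@TensorTrans _ ([:: (a *: m, n); (b *: m, n)]
                          ++ (tscale_seq a s ++ tscale_seq b s))).
  exact: TensorCat (TensorAddl _ _ _) IHs.
apply: (TensorCat (TensorRefl [:: (a *: m, n)])).
rewrite -[X in tensor_eq _ (_ ++ X)]cat1s -[X in tensor_eq X _]cat1s !catA.
by apply: TensorCat; [exact: TensorComm | exact: TensorRefl].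
Qed.

Lemma tscale0 x : tscale 0 x = tzero.
Proof.
elim/tensorW: x => s; rewrite tscale_pi; apply/tensor_classP.
elim: s => [|[m n] s IHs] /=; first exact: TensorRefl.
by rewrite scale0r -cat1s; apply: (TensorCat (TensorZero _) IHs).
Qed.

Lemma taddN : left_inverse tzero topp tadd.
Proof.
by move=> x; rewrite /topp -[X in tadd _ X]tscale1 -tscaleDl addNr tscale0.
Qed.

HB.instance Definition _ :=
  GRing.isZmodule.Build tensor taddA taddC tadd0 taddN.
HB.instance Definition _ := GRing.Zmodule_isLmodule.Build A tensor
  tscaleA tscale1 tscaleDr tscaleDl.

Definition pure_tensor (m : M) (n : N) : tensor := tensor_class [:: (m, n)].

End Tensor.

Section TensorMap.
Variables (A : comNzRingType) (M N N' : lmodType A) (f : {linear N -> N'}).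

(* The map id_M (x) f. *)
Definition tensor_map (x : tensor M N) : tensor M N' :=
  tensor_class [seq (y.1, f y.2) | y <- tensor_list x].

Lemma tensor_map_eq (s t : seq (M * N)) : tensor_eq s t ->
  tensor_eq [seq (y.1, f y.2) | y <- s] [seq (y.1, f y.2) | y <- t].
Proof.
elim=> {s t}
  [s|s t _ h|s t u _ h _ h'|s t u v _ h _ h'|s t|n|m m' n|m n n'|b m n] /=.
- exact: TensorRefl.
- exact: TensorSym.
- exact: TensorTrans h h'.
- by rewrite !map_cat; apply: TensorCat.
- by rewrite !map_cat; apply: TensorComm.
- exact: TensorZero.
- exact: TensorAddl.
- by rewrite linearD; apply: TensorAddr.
- by rewrite linearZ; apply: TensorScale.
Qed.

Lemma tensor_map_pi (s : seq (M * N)) :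
  tensor_map (tensor_class s) = tensor_class [seq (y.1, f y.2) | y <- s].
Proof. by apply/tensor_classP/tensor_map_eq/tensor_listP. Qed.

Lemma tensor_map_pure m n :
  tensor_map (pure_tensor m n) = pure_tensor m (f n).
Proof. by rewrite /pure_tensor tensor_map_pi. Qed.

Lemma tensor_map_is_linear : linear tensor_map.
Proof.
move=> a; elim/tensorW=> s; elim/tensorW=> t.
rewrite [a *: _]tscale_pi [_ + _]tadd_pi !tensor_map_pi.
rewrite [a *: _]tscale_pi [RHS]tadd_pi map_cat.
by rewrite /tscale_seq -!map_comp.
Qed.

HB.instance Definition _ := GRing.isLinear.Build A (tensor M N) (tensor M N')
  *:%R tensor_map tensor_map_is_linear.

End TensorMap.

Section TensorUniversal.
Variables (A : comNzRingType) (M N P : lmodType A) (b : M -> N -> P).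
Hypothesis b_linl : forall n, linear (b^~ n).
Hypothesis b_linr : forall m, linear (b m).

Lemma tensor_universal :
  exists! g : tensor M N -> P,
    linear g /\ forall m n, g (pure_tensor m n) = b m n.
Proof.
have lDl m m' n : b (m + m') n = b m n + b m' n.
  by have := b_linl n 1 m m'; rewrite !scale1r.
have lDr m n n' : b m (n + n') = b m n + b m n'.
  by have := b_linr m 1 n n'; rewrite !scale1r.
have l0l n : b 0 n = 0.
  by apply: (@addrI _ (b 0 n)); rewrite -lDl !addr0.
have l0r m : b m 0 = 0.
  by apply: (@addrI _ (b m 0)); rewrite -lDr !addr0.
have lZl a m n : b (a *: m) n = a *: b m n.
  by have := b_linl n a m 0; rewrite !addr0 l0l addr0.
have lZr a m n : b m (a *: n) = a *: b m n.
  by have := b_linr m a n 0; rewrite !addr0 l0r addr0.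
pose S (s : seq (M * N)) := \sum_(x <- s) b x.1 x.2.
have S_eq s t : tensor_eq s t -> S s = S t.
  rewrite /S; elim=> {s t} //=.
  - by move=> s t u _ -> _ ->.
  - by move=> s t u v _ h _ h'; rewrite !big_cat /= h h'.
  - by move=> s t; rewrite !big_cat /= addrC.
  - by move=> n; rewrite big_seq1 big_nil /= l0l.
  - by move=> m m' n; rewrite big_seq1 big_cons big_seq1 /= lDl.
  - by move=> m n n'; rewrite big_seq1 big_cons big_seq1 /= lDr.
  - by move=> a m n; rewrite !big_seq1 /= lZl lZr.
have S_pi s : S (tensor_list (tensor_class s)) = S s by exact/S_eq/tensor_listP.
exists (fun x => S (tensor_list x)); split.
  split=> [a|m n]; last by rewrite S_pi /S big_seq1.
  elim/tensorW=> s; elim/tensorW=> t.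
  rewrite [a *: _]tscale_pi [X in tensor_list X]tadd_pi
    !S_pi /S big_cat /= big_map.
  by rewrite scaler_sumr; congr (_ + _); apply: eq_bigr => x _; rewrite lZl.
move=> g [g_lin g_b]; apply/funext; elim/tensorW=> s; rewrite S_pi /S.
have gD x y : g (x + y) = g x + g y.
  by have := g_lin 1 x y; rewrite !scale1r.
have g0 : g 0 = 0 by apply: (@addrI _ (g 0)); rewrite -gD !addr0.
elim: s => [|[m n] s IHs]; first by rewrite big_nil; exact: esym g0.
rewrite big_cons /= IHs -g_b -gD; congr g.
exact: (@tadd_pi _ _ _ [:: (m, n)] s).
Qed.

End TensorUniversal.

Section Dimensions.
Variable A : comNzRingType.

Definition projective (P : lmodType A) : Prop :=
  forall (N N' : lmodType A) (g : {linear N -> N'}) (f : {linear P -> N'}),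
    (forall y, exists x, g x = y) ->
    exists h : {linear P -> N}, forall x, g (h x) = f x.

Definition flat (M : lmodType A) : Prop :=
  forall (N N' : lmodType A) (f : {linear N -> N'}),
    injective f -> injective (@tensor_map A M N N' f).

Definition exact_at (L M N : lmodType A)
    (f : {linear L -> M}) (g : {linear M -> N}) : Prop :=
  forall y, g y = 0 <-> exists x, f x = y.

(* 0 -> P n -> ... -> P 1 -> P 0 -> M -> 0 exact, all P i in the class C; the
   resolution is extended by P i = 0 for i > n. *)
Definition has_resolution (C : lmodType A -> Prop) (M : lmodType A) (n : nat)
    : Prop :=
  exists (P : nat -> lmodType A) (d : forall i, {linear P i.+1 -> P i})
         (e : {linear P 0%N -> M}),
  [/\ forall i, C (P i),
      forall i, (n < i)%N -> forall x : P i, x = 0,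
      forall y, exists x, e x = y,
      exact_at (d 0%N) e
    & forall i, exact_at (d i.+1) (d i)].

End Dimensions.

(* Values in nat extended by infinity, the latter being None. *)
Definition least (P : nat -> Prop) : option nat :=
  match pselect (exists n, `[< P n >]) with
  | left exP => Some (ex_minn exP)
  | right _ => None
  end.

Lemma leastP (P : nat -> Prop) (n : nat) :
  least P = Some n <-> P n /\ forall m, P m -> (n <= m)%N.
Proof.
rewrite /least; case: pselect => [exP|nP]; last first.
  by split=> // -[Pn _]; case: nP; exists n; apply/asboolP.
case: ex_minnP => m /asboolP Pm m_min; split=> [[<-]|[Pn n_min]].
  by split=> // k Pk; apply/m_min/asboolP.
congr Some; apply/eqP; rewrite eqn_leq n_min // andbT.
exact/m_min/asboolP.
Qed.

Definition le_enat (k : option nat) (n : nat) : Prop :=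
  if k is Some m then (m <= n)%N else False.

Definition sup_enat (I : Type) (F : I -> option nat) : option nat :=
  least (fun n => forall i, le_enat (F i) n).

Definition projdim (A : comNzRingType) (M : lmodType A) : option nat :=
  least (has_resolution (@projective A) M).

Definition flatdim (A : comNzRingType) (M : lmodType A) : option nat :=
  least (has_resolution (@flat A) M).

Definition gldim (A : comNzRingType) : option nat := sup_enat (@projdim A).

Definition wdim (A : comNzRingType) : option nat := sup_enat (@flatdim A).

Section PerfectClosure.
Variables (R : comNzRingType) (p : nat) (charRp : p \in [pchar R]).

Definition frob (n : nat) (a : R) : R := iter n (pFrobenius_aut charRp) a.

Lemma frobD n a b : frob n (a + b) = frob n a + frob n b.
Proof. by rewrite /frob; elim: n => //= n ->; rewrite rmorphD. Qed.
Lemma frobM n a b : frob n (a * b) = frob n a * frob n b.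
Proof. by rewrite /frob; elim: n => //= n ->; rewrite rmorphM. Qed.
Lemma frobN n a : frob n (- a) = - frob n a.
Proof. by rewrite /frob; elim: n => //= n ->; rewrite rmorphN. Qed.
Lemma frob0 n : frob n 0 = 0.
Proof. by rewrite /frob; elim: n => //= n ->; rewrite rmorph0. Qed.
Lemma frob1 n : frob n 1 = 1.
Proof. by rewrite /frob; elim: n => //= n ->; rewrite rmorph1. Qed.
Lemma frob_add m n a : frob m (frob n a) = frob (m + n) a.
Proof. by rewrite /frob iterD. Qed.

(* (n, a) is the image in the colimit of the element a of the n-th copy of R;
   two such elements are identified when their images agree in some later
   copy, the (k + m + n)-th one. *)
Definition perf_eq (x y : nat * R) : Prop :=
  exists k, frob (k + y.1) x.2 = frob (k + x.1) y.2.

Definition perf_rel (x y : nat * R) : bool := `[< perf_eq x y >].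

Lemma perf_relP x y : reflect (perf_eq x y) (perf_rel x y).
Proof. exact: asboolP. Qed.

Lemma perf_rel_refl : reflexive perf_rel.
Proof. by move=> x; apply/perf_relP; exists 0%N. Qed.

Lemma perf_rel_sym : symmetric perf_rel.
Proof. by move=> x y; apply/perf_relP/perf_relP => -[k h]; exists k. Qed.

Lemma perf_rel_trans : transitive perf_rel.
Proof.
move=> [m b] [n a] [l c] /perf_relP[/= k h] /perf_relP[/= k' h'].
apply/perf_relP; exists (k + k' + m)%N => /=.
have -> : (k + k' + m + l = (k' + l) + (k + m))%N by lia.
rewrite -frob_add h frob_add.
have -> : (k' + l + (k + n) = (k + n) + (k' + l))%N by lia.
by rewrite -frob_add h' frob_add; congr frob; lia.
Qed.

Canonical perf_equiv :=
  EquivRel perf_rel perf_rel_refl perf_rel_sym perf_rel_trans.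

Definition perfect_closure : Type := {eq_quot perf_rel}.
HB.instance Definition _ := Choice.on perfect_closure.
Local Notation Q := perfect_closure.

Definition perf_class (x : nat * R) : Q := \pi_{eq_quot perf_rel} x.
Definition perf_pair (x : Q) : nat * R := repr (x : {eq_quot perf_rel}).

Lemma perf_pairK x : perf_class (perf_pair x) = x.
Proof. exact: reprK. Qed.

Lemma perfW (P : Q -> Prop) : (forall x, P (perf_class x)) -> forall x, P x.
Proof. by move=> h x; rewrite -(perf_pairK x). Qed.

Lemma perf_classP x y : perf_class x = perf_class y <-> perf_eq x y.
Proof.
split; first by move/eqquotP/perf_relP.
by move=> h; apply/eqquotP/perf_relP.
Qed.

Lemma perf_pairP x : perf_eq (perf_pair (perf_class x)) x.
Proof. by apply/perf_classP; rewrite perf_pairK. Qed.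

Definition add_pair (x y : nat * R) :=
  ((x.1 + y.1)%N, frob y.1 x.2 + frob x.1 y.2).
Definition mul_pair (x y : nat * R) :=
  ((x.1 + y.1)%N, frob y.1 x.2 * frob x.1 y.2).
Definition opp_pair (x : nat * R) := (x.1, - x.2).

Definition padd (x y : Q) : Q :=
  perf_class (add_pair (perf_pair x) (perf_pair y)).
Definition pmul (x y : Q) : Q :=
  perf_class (mul_pair (perf_pair x) (perf_pair y)).
Definition popp (x : Q) : Q := perf_class (opp_pair (perf_pair x)).
Definition pzero : Q := perf_class (0%N, 0).
Definition pone : Q := perf_class (0%N, 1).

Let pair_eq (x y x' y' : nat * R) :
  perf_eq x x' -> perf_eq y y' ->
  exists k, frob (k + (x'.1 + y'.1)) (frob y.1 x.2)
            = frob (k + (x.1 + y.1)) (frob y'.1 x'.2)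
         /\ frob (k + (x'.1 + y'.1)) (frob x.1 y.2)
            = frob (k + (x.1 + y.1)) (frob x'.1 y'.2).
Proof.
case: x y x' y' => [n a] [m b] [n' a'] [m' b'] [/= k h] [/= l h'].
exists (k + l)%N; rewrite !frob_add; split.
- have -> : (k + l + (n' + m') + m = (l + m' + m) + (k + n'))%N by lia.
  by rewrite -frob_add h frob_add; congr frob; lia.
- have -> : (k + l + (n' + m') + n = (k + n + n') + (l + m'))%N by lia.
  by rewrite -frob_add h' frob_add; congr frob; lia.
Qed.

Lemma padd_pi x y : padd (perf_class x) (perf_class y)
  = perf_class (add_pair x y).
Proof.
apply/perf_classP; have [k [h h']] := pair_eq (perf_pairP x) (perf_pairP y).
by exists k; rewrite /= !frobD h h'.
Qed.

Lemma pmul_pi x y : pmul (perf_class x) (perf_class y)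
  = perf_class (mul_pair x y).
Proof.
apply/perf_classP; have [k [h h']] := pair_eq (perf_pairP x) (perf_pairP y).
by exists k; rewrite /= !frobM h h'.
Qed.

Lemma popp_pi x : popp (perf_class x) = perf_class (opp_pair x).
Proof.
apply/perf_classP; have [k h] := perf_pairP x.
by exists k; rewrite /= !frobN h.
Qed.

Lemma paddA : associative padd.
Proof.
elim/perfW=> x; elim/perfW=> y; elim/perfW=> z.
rewrite (padd_pi y) (padd_pi x) (padd_pi x) (padd_pi (add_pair x y)).
congr (perf_class _); rewrite /add_pair /= !frobD !frob_add addnA addrA.
by congr (_, _ + _ + _); congr frob; lia.
Qed.

Lemma paddC : commutative padd.
Proof.
elim/perfW=> x; elim/perfW=> y.
rewrite (padd_pi x) (padd_pi y).
by rewrite /add_pair addnC addrC.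
Qed.

Lemma padd0 : left_id pzero padd.
Proof.
by elim/perfW=> -[n a]; rewrite padd_pi /add_pair /= frob0 !add0r add0n.
Qed.

Lemma paddN : left_inverse pzero popp padd.
Proof.
elim/perfW=> -[n a]; rewrite popp_pi padd_pi /add_pair /= frobN addNr.
by apply/perf_classP; exists 0%N; rewrite /= !frob0.
Qed.

Lemma pmulA : associative pmul.
Proof.
elim/perfW=> x; elim/perfW=> y; elim/perfW=> z.
rewrite (pmul_pi y) (pmul_pi x) (pmul_pi x) (pmul_pi (mul_pair x y)).
congr (perf_class _); rewrite /mul_pair /= !frobM !frob_add addnA mulrA.
by congr (_, _ * _ * _); congr frob; lia.
Qed.

Lemma pmulC : commutative pmul.
Proof.
elim/perfW=> x; elim/perfW=> y.
rewrite (pmul_pi x) (pmul_pi y).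
by rewrite /mul_pair addnC mulrC.
Qed.

Lemma pmul1 : left_id pone pmul.
Proof.
by elim/perfW=> -[n a]; rewrite pmul_pi /mul_pair /= frob1 mul1r add0n.
Qed.

Lemma pmulD : left_distributive pmul padd.
Proof.
elim/perfW=> -[n a]; elim/perfW=> -[m b]; elim/perfW=> -[l c].
rewrite (padd_pi (n, a)) (pmul_pi (n, a)) (pmul_pi (m, b)).
rewrite (pmul_pi (add_pair _ _)) (padd_pi (mul_pair _ _)).
apply/perf_classP; exists 0%N => /=.
rewrite !(frobD, frobM, frob_add) mulrDl.
by congr (_ * _ + _ * _); congr frob; lia.
Qed.

Lemma pone_neq0 : pone != pzero.
Proof.
apply/eqP => /perf_classP[k /=]; rewrite frob0 frob1 => /eqP.
by rewrite oner_eq0.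
Qed.

HB.instance Definition _ := GRing.isZmodule.Build Q paddA paddC padd0 paddN.
HB.instance Definition _ := GRing.Zmodule_isComNzRing.Build Q
  pmulA pmulC pmul1 pmulD pone_neq0.

End PerfectClosure.

Section NodalCubic.
Variable p : nat.

(* F_p[x,y] is {poly {poly 'F_p}}: x is the inner variable 'X%:P and y the
   outer variable 'X (Rocq prints 'X%:P as 'Y). *)
Definition nodal_poly : {poly {poly 'F_p}} :=
  'X^2 - ('X%:P ^+ 3 + 'X%:P ^+ 2).

(* {poly %/ h} is the quotient by h only for h monic of positive degree;
   mk_monic_nodal below ensures that this is the case here. *)
Definition nodal_cubic : comNzRingType := {poly %/ nodal_poly}.

Let tail_size : (size ('X%:P ^+ 3 + 'X%:P ^+ 2 : {poly {poly 'F_p}})%R < 3)%N.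
Proof.
by rewrite -!rmorphXn -rmorphD /= (leq_ltn_trans (size_polyC_leq1 _)).
Qed.

Lemma nodal_poly_size : size nodal_poly = 3%N.
Proof. by rewrite /nodal_poly size_polyDl ?size_polyXn ?size_polyN. Qed.

Lemma nodal_poly_monic : nodal_poly \is monic.
Proof.
rewrite monicE /nodal_poly lead_coefDl ?lead_coefXn //.
by rewrite size_polyXn size_polyN.
Qed.

Lemma mk_monic_nodal : mk_monic nodal_poly = nodal_poly.
Proof. by rewrite /mk_monic nodal_poly_size nodal_poly_monic. Qed.

Lemma nodal_pchar : prime p -> p \in [pchar nodal_cubic].
Proof.
move=> p_pr; apply/andP; split=> //; apply/eqP.
have h : p%:R = 0 :> {poly {poly 'F_p}}.
  by rewrite -[p%:R]polyC_natr -[p%:R]polyC_natr pchar_Fp_0 // !polyC0.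
rewrite -[p%:R](rmorph_nat (in_qpoly nodal_poly)) h.
exact: rmorph0.
Qed.

End NodalCubic.

(* Main.v *)
(* With t = y / x the perfect closure A of the nodal cubic is the ring of all f
   in the perfect closure B of F_p[t] with f(1) = f(-1), so A = F_p + J, where
   J = {f(1) = f(-1) = 0} is an ideal of B as well. Put c_n = x^(1/p^n), where
   x = t^2 - 1. Then J is the increasing union of the A c_n, hence flat of
   projective dimension at most 1. As B is Bezout and countable, J I is for each
   ideal I of A an increasing union of principal ideals too, while I / J I is a
   vector space over A / J = F_p. So I has flat dimension at most 1 and
   projective dimension at most 2, whence the upper bounds. By Baer's criterion
   they need only be checked on ideals, as the injectivity of a third cosyzygy
   for projective dimensions and, flatness of M being injectivity of
   Hom(M, F_p), of the dual of a second syzygy for flat dimensions.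
   For the lower bounds take M = A / (x, y): its second syzygy
   {(u, v) : x u + y v = 0} is isomorphic to J, which is not projective, and its
   first syzygy (x, y) = x B is not flat. *)
From HB Require Import structures.
Require Import Defs.
From mathcomp Require Import all_boot all_order all_algebra.
From mathcomp Require Import boolp classical_sets functions ring.

Set Implicit Arguments.
Unset Strict Implicit.
Unset Printing Implicit Defensive.

Import GRing.Theory.
Local Open Scope ring_scope.
Local Open Scope quotient_scope.

(** Every A-module is killed by the prime p, so every additive embedding splits. Hence additive
    Hom(-, V) is exact when p V = 0, the coinduced modules Hom(A, N) are injective, and functionals
    to F_p separate points. Ext is never constructed: Ext^(n+1)(M, N) = 0 means that maps from M
    lift along the projection of a coinduced module onto the (n+1)-st cosyzygy of N. Both upper
    bounds come from one statement: a second cosyzygy is injective as soon as lim^1 vanishes for the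
    towers of multiplications on the module and on its first injective term. This holds on all
    Hom(M, V), thus on duals, but not on every N, which must first be replaced by a quotient of a
    coinduced module; that is the gap between 2 and 3. The same lim^1 obstructs the projectivity of
    J. The condition p <> 2 keeps the glued points 1 and -1 apart and lets t |-> - t separate even
    from odd polynomials. *)

Definition mk_linear (A : comNzRingType) (U V : lmodType A) (f : U -> V)
  (f_lin : linear f) : {linear U -> V} :=
  HB.pack f (GRing.isLinear.Build A U V *:%R f f_lin).

Lemma morphD_zmod (U V : zmodType) (f : U -> V) :
  {morph f : x y / x + y} -> zmod_morphism f.
Proof.
move=> fD x y; apply: (@addIr _ (f y)).
by rewrite -fD !subrK.
Qed.

Definition mk_additive (U V : zmodType) (f : U -> V)
  (fD : {morph f : x y / x + y}) : {additive U -> V} :=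
  HB.pack f (GRing.isZmodMorphism.Build U V f (morphD_zmod fD)).

(** * Modules, Baer's criterion and the duality Hom(-, F_p) *)

Section Submodules.
Variables (A : comNzRingType) (V : lmodType A).

Record submodule := Submodule {
  in_submodule :> V -> Prop;
  submodule0 : in_submodule 0;
  submoduleP : forall a u v,
    in_submodule u -> in_submodule v -> in_submodule (a *: u + v) }.

Implicit Types S : submodule.

Definition submodule_pred S : {pred V} := fun v => `[< S v >].

Lemma submodule_closed S : submod_closed (submodule_pred S).
Proof.
split=> [|a u v]; first exact/asboolP/submodule0.
by move=> /asboolP hu /asboolP hv; apply/asboolP/submoduleP.
Qed.

HB.instance Definition _ S := GRing.isSubmodClosed.Build A V
  (submodule_pred S) (submodule_closed S).

Record submodule_type S :=
  SubmoduleElt { submodule_val : V; _ : submodule_val \in submodule_pred S }.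

HB.instance Definition _ S := [isSub for @submodule_val S].
HB.instance Definition _ S := [Choice of submodule_type S by <:].
HB.instance Definition _ S :=
  [SubChoice_isSubLmodule of submodule_type S by <:].

Definition submodule_inj S : {linear submodule_type S -> V} :=
  mk_linear (linearP (val : submodule_type S -> V)).

Definition submodule_elt S (v : V) (hv : S v) : submodule_type S :=
  SubmoduleElt (introT (asboolP (S v)) hv).

Lemma submodule_in S (u : submodule_type S) : S (submodule_inj S u).
Proof. by apply/asboolP; case: u. Qed.

Lemma submodule_inj_inj S : injective (submodule_inj S).
Proof. exact: val_inj. Qed.

Lemma submoduleD S u v : S u -> S v -> S (u + v).
Proof. by move=> hu hv; rewrite -[u]scale1r; apply: submoduleP. Qed.

Lemma submoduleZ S a u : S u -> S (a *: u).
Proof.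
by move=> hu; rewrite -[a *: u]addr0; apply: submoduleP => //; apply: submodule0.
Qed.

Lemma submoduleN S u : S u -> S (- u).
Proof. by rewrite -scaleN1r; apply: submoduleZ. Qed.

Lemma submoduleB S u v : S u -> S v -> S (u - v).
Proof. by move=> hu hv; rewrite addrC -scaleN1r; apply: submoduleP. Qed.

End Submodules.

Section Corestriction.
Variables (A : comNzRingType) (U V : lmodType A) (S : submodule V).
Variables (f : {linear U -> V}) (fS : forall u, S (f u)).

Definition corestr_fun u : submodule_type S := submodule_elt (fS u).

Lemma corestr_is_linear : linear corestr_fun.
Proof. by move=> a u v; apply: val_inj; rewrite /= linearP. Qed.

Definition corestr : {linear U -> submodule_type S} :=
  mk_linear corestr_is_linear.

Lemma corestrE u : submodule_inj S (corestr u) = f u.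
Proof. by []. Qed.

End Corestriction.

Section KernelImage.
Variables (A : comNzRingType) (U V : lmodType A) (f : {linear U -> V}).

Lemma ker_closed a u v : f u = 0 -> f v = 0 -> f (a *: u + v) = 0.
Proof. by move=> hu hv; rewrite linearP hu hv scaler0 addr0. Qed.

Definition kernel : submodule U :=
  @Submodule A U (fun u => f u = 0) (linear0 f) ker_closed.

Definition ker_type : lmodType A := submodule_type kernel.

Definition ker_inj : {linear ker_type -> U} := submodule_inj kernel.

Lemma exact_ker : exact_at ker_inj f.
Proof.
move=> y; split=> [hy|[x <-]]; last exact: submodule_in x.
by exists (submodule_elt (S := kernel) hy).
Qed.

End KernelImage.

Section QuotientModule.
Variables (A : comNzRingType) (V : lmodType A) (S : submodule V).

Definition qm_rel (u v : V) : bool := `[< S (u - v) >].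

Lemma qm_refl : reflexive qm_rel.
Proof. by move=> u; apply/asboolP; rewrite subrr; apply: submodule0. Qed.

Lemma qm_sym : symmetric qm_rel.
Proof.
by move=> u v; apply/asboolP/asboolP => h;
  rewrite -opprB; apply: submoduleN.
Qed.

Lemma qm_trans : transitive qm_rel.
Proof.
move=> v u w /asboolP h1 /asboolP h2; apply/asboolP.
by rewrite -[u](subrK v) -addrA; apply: submoduleD.
Qed.

Canonical qm_equiv := EquivRel qm_rel qm_refl qm_sym qm_trans.

Definition quot_module : Type := {eq_quot qm_rel}.
HB.instance Definition _ := Choice.on quot_module.

Definition qm_class (v : V) : quot_module := \pi_{eq_quot qm_rel} v.
Definition qm_repr (x : quot_module) : V := repr (x : {eq_quot qm_rel}).

Lemma qm_reprK x : qm_class (qm_repr x) = x.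
Proof. exact: reprK. Qed.

Lemma qm_classP u v : qm_class u = qm_class v <-> S (u - v).
Proof.
split; first by move/eqquotP/asboolP.
by move=> h; apply/eqquotP/asboolP.
Qed.

Lemma qmW (P : quot_module -> Prop) :
  (forall v, P (qm_class v)) -> forall x, P x.
Proof. by move=> h x; rewrite -(qm_reprK x). Qed.

Definition qm_add x y := qm_class (qm_repr x + qm_repr y).
Definition qm_scale a x := qm_class (a *: qm_repr x).
Definition qm_opp x := qm_class (- qm_repr x).

Lemma qm_repr_class v : S (qm_repr (qm_class v) - v).
Proof. by apply/qm_classP; rewrite qm_reprK. Qed.

Lemma qm_addE u v : qm_add (qm_class u) (qm_class v) = qm_class (u + v).
Proof.
apply/qm_classP; rewrite opprD addrACA.
by apply: submoduleD; apply: qm_repr_class.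
Qed.

Lemma qm_scaleE a v : qm_scale a (qm_class v) = qm_class (a *: v).
Proof.
apply/qm_classP; rewrite -scalerBr.
by apply: submoduleZ; apply: qm_repr_class.
Qed.

Lemma qm_oppE v : qm_opp (qm_class v) = qm_class (- v).
Proof.
apply/qm_classP; rewrite -opprD.
by apply: submoduleN; apply: qm_repr_class.
Qed.

Lemma qm_addA : associative qm_add.
Proof.
by elim/qmW=> u; elim/qmW=> v; elim/qmW=> w; rewrite !qm_addE addrA.
Qed.

Lemma qm_addC : commutative qm_add.
Proof. by elim/qmW=> u; elim/qmW=> v; rewrite !qm_addE addrC. Qed.

Lemma qm_add0 : left_id (qm_class 0) qm_add.
Proof. by elim/qmW=> u; rewrite qm_addE add0r. Qed.

Lemma qm_addN : left_inverse (qm_class 0) qm_opp qm_add.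
Proof. by elim/qmW=> u; rewrite qm_oppE qm_addE addNr. Qed.

HB.instance Definition _ :=
  GRing.isZmodule.Build quot_module qm_addA qm_addC qm_add0 qm_addN.

Lemma qm_scaleA a b x : qm_scale a (qm_scale b x) = qm_scale (a * b) x.
Proof. by elim/qmW: x => u; rewrite !qm_scaleE scalerA. Qed.

Lemma qm_scale1 : left_id 1 qm_scale.
Proof. by elim/qmW=> u; rewrite qm_scaleE scale1r. Qed.

Lemma qm_scaleDr : right_distributive qm_scale +%R.
Proof.
move=> a; elim/qmW=> u; elim/qmW=> v.
rewrite [qm_class u + _]qm_addE !qm_scaleE [RHS]qm_addE.
by rewrite scalerDr.
Qed.

Lemma qm_scaleDl x : {morph qm_scale^~ x : a b / a + b}.
Proof.
move=> a b; elim/qmW: x => u.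
by rewrite !qm_scaleE [RHS]qm_addE scalerDl.
Qed.

HB.instance Definition _ := GRing.Zmodule_isLmodule.Build A quot_module
  qm_scaleA qm_scale1 qm_scaleDr qm_scaleDl.

Lemma qm_class_is_linear : linear qm_class.
Proof.
move=> a u v; rewrite -[RHS]/(qm_add (qm_scale a _) _).
by rewrite qm_scaleE qm_addE.
Qed.

Definition quot_pi : {linear V -> quot_module} := mk_linear qm_class_is_linear.

Lemma quot_pi_surj y : exists x, quot_pi x = y.
Proof. by exists (qm_repr y); apply: qm_reprK. Qed.

Lemma quot_pi0 v : quot_pi v = 0 <-> S v.
Proof.
rewrite -(linear0 quot_pi); split; first by move/qm_classP; rewrite subr0.
by move=> h; apply/qm_classP; rewrite subr0.
Qed.

End QuotientModule.

(** * Direct sums and free modules *)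

Section FiniteSupport.
Variables (A : comNzRingType) (S : choiceType) (M : lmodType A).

Definition fin_supp (f : S -> M) : Prop :=
  exists s : seq S, forall x, x \notin s -> f x = 0.

Lemma fin_supp0 : fin_supp (0 : S -> M).
Proof. by exists [::]. Qed.

Lemma fin_suppP a (f g : S -> M) :
  fin_supp f -> fin_supp g -> fin_supp (a *: f + g).
Proof.
move=> [s hs] [t ht]; exists (s ++ t) => x; rewrite mem_cat negb_or.
case/andP=> xs xt; change (a *: f x + g x = 0).
by rewrite hs // ht // scaler0 addr0.
Qed.

Definition fsupp_submodule : submodule (S -> M) :=
  @Submodule A (S -> M) fin_supp fin_supp0 fin_suppP.

(** The direct sum of copies of M indexed by S. With M = A it is the free module on S; with S = nat
    it carries the telescope that computes lim^1. *)
Definition fsupp : lmodType A := submodule_type fsupp_submodule.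

Definition fs_fun (f : fsupp) : S -> M := submodule_val f.

Lemma fs_funD f g x : fs_fun (f + g) x = fs_fun f x + fs_fun g x.
Proof. by []. Qed.

Lemma fs_funZ a f x : fs_fun (a *: f) x = a *: fs_fun f x.
Proof. by []. Qed.

Lemma fsuppP (f g : fsupp) : fs_fun f =1 fs_fun g -> f = g.
Proof. by move=> h; apply: val_inj; apply/funext. Qed.

Lemma fs_suppP (f : fsupp) : exists s, uniq s /\
  forall x, x \notin s -> fs_fun f x = 0.
Proof.
have [s hs] := submodule_in f; exists (undup s); rewrite undup_uniq.
by split=> // x; rewrite mem_undup; apply: hs.
Qed.

Definition fs_supp (f : fsupp) : seq S := sval (cid (fs_suppP f)).

Lemma fs_supp_uniq f : uniq (fs_supp f).
Proof. by rewrite /fs_supp; case: cid => s []. Qed.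

Lemma fs_supp0 f x : x \notin fs_supp f -> fs_fun f x = 0.
Proof. by rewrite /fs_supp; case: cid => s [] _ /= h; apply: h. Qed.

Definition delta_fun (x : S) (m : M) : S -> M :=
  fun y => if y == x then m else 0.

Lemma delta_fin_supp x m : fin_supp (delta_fun x m).
Proof.
by exists [:: x] => y; rewrite inE /delta_fun => /negbTE ->.
Qed.

Definition fs_delta (x : S) (m : M) : fsupp :=
  submodule_elt (S := fsupp_submodule) (delta_fin_supp x m).

Lemma fs_deltaE x m y : fs_fun (fs_delta x m) y = if y == x then m else 0.
Proof. by []. Qed.

Section Sum.
Variables (W : zmodType) (e : S -> {additive M -> W}).

Definition fs_sum (f : fsupp) : W := \sum_(x <- fs_supp f) e x (fs_fun f x).

(** Terms outside the support vanish, so both lists can be cut down to their common part, up to a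
    permutation. *)
Lemma fs_sum_seq f (s : seq S) : uniq s ->
  (forall x, x \notin s -> fs_fun f x = 0) ->
  fs_sum f = \sum_(x <- s) e x (fs_fun f x).
Proof.
move=> us hs; have key (u v : seq S) : uniq u -> uniq v ->
    (forall x, x \notin v -> fs_fun f x = 0) ->
    \sum_(x <- u | x \in v) e x (fs_fun f x) = \sum_(x <- u) e x (fs_fun f x).
  move=> uu uv hv; rewrite [RHS](bigID (mem v)) /= [X in _ + X]big1 ?addr0 //.
  by move=> x xv; rewrite hv // raddf0.
rewrite /fs_sum -(key _ s) //; last exact: fs_supp_uniq.
rewrite -[RHS](key _ (fs_supp f)) ?fs_supp_uniq //; last exact: fs_supp0.
rewrite -big_filter -[RHS]big_filter; apply: perm_big; apply: uniq_perm.
- by rewrite filter_uniq ?fs_supp_uniq.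
- by rewrite filter_uniq.
- by move=> x; rewrite !mem_filter andbC.
Qed.

Lemma fs_sumE2 f g : exists s, uniq s /\
  [/\ fs_sum f = \sum_(x <- s) e x (fs_fun f x),
      fs_sum g = \sum_(x <- s) e x (fs_fun g x)
    & forall h, (forall x, fs_fun f x = 0 -> fs_fun g x = 0 -> fs_fun h x = 0)
        -> fs_sum h = \sum_(x <- s) e x (fs_fun h x)].
Proof.
set s := undup (fs_supp f ++ fs_supp g).
have sP x : x \notin s -> fs_fun f x = 0 /\ fs_fun g x = 0.
  by rewrite mem_undup mem_cat negb_or => /andP[/fs_supp0 -> /fs_supp0 ->].
exists s; rewrite undup_uniq; split=> //; split.
- by apply: fs_sum_seq; rewrite ?undup_uniq // => x /sP[].
- by apply: fs_sum_seq; rewrite ?undup_uniq // => x /sP[].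
- by move=> h hh; apply: fs_sum_seq; rewrite ?undup_uniq // => x /sP[]; auto.
Qed.

Lemma fs_sumD : {morph fs_sum : f g / f + g}.
Proof.
move=> f g; have [s [us [-> -> h]]] := fs_sumE2 f g.
rewrite h => [|x hf hg]; last by rewrite fs_funD hf hg addr0.
by rewrite -big_split; apply: eq_bigr => x _; rewrite fs_funD raddfD.
Qed.

Lemma fs_sum_delta x m : fs_sum (fs_delta x m) = e x m.
Proof.
rewrite (@fs_sum_seq _ [:: x]) // => [|y].
  by rewrite big_seq1 fs_deltaE eqxx.
by rewrite inE fs_deltaE => /negbTE ->.
Qed.

End Sum.

Lemma fs_sum_is_linear (W : lmodType A) (e : S -> {linear M -> W}) :
  linear (fs_sum e).
Proof.
move=> a f g; rewrite fs_sumD; congr (_ + _).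
have [s [us [-> _ h]]] := fs_sumE2 e f f.
rewrite h => [|x hf _]; last by rewrite fs_funZ hf scaler0.
rewrite scaler_sumr; apply: eq_bigr => x _. 
change (e x (a *: fs_fun f x) = a *: e x (fs_fun f x)).
by rewrite linearZ.
Qed.

Lemma fs_decomp f : f = \sum_(x <- fs_supp f) fs_delta x (fs_fun f x).
Proof.
apply: fsuppP => y.
have sumE (s : seq S) : fs_fun (\sum_(x <- s) fs_delta x (fs_fun f x)) y
    = \sum_(x <- s) fs_fun (fs_delta x (fs_fun f x)) y.
  elim: s => [|x s IHs]; first by rewrite !big_nil.
  by rewrite !big_cons fs_funD IHs.
rewrite sumE; have [ys|/[dup] ys /fs_supp0 ->] := boolP (y \in fs_supp f).
  rewrite (bigD1_seq y) ?fs_supp_uniq // fs_deltaE eqxx.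
  rewrite big1 => [|x xy]; first exact: esym (addr0 _).
  by apply: (etrans (fs_deltaE _ _ _)); rewrite eq_sym (negbTE xy).
rewrite big1_seq // => x /= xs; apply: (etrans (fs_deltaE _ _ _)).
by case: eqP => // yx; rewrite yx xs in ys.
Qed.

Lemma fs_ext (W : zmodType) (h h' : {additive fsupp -> W}) :
  (forall x m, h (fs_delta x m) = h' (fs_delta x m)) -> h =1 h'.
Proof.
by move=> hh f; rewrite (fs_decomp f) !raddf_sum; apply: eq_bigr => x _.
Qed.

End FiniteSupport.

Section FreeModule.
Variables (A : comNzRingType) (S : choiceType).

Definition free_module : lmodType A := fsupp S (A^o : lmodType A).

Lemma free_lift (N : lmodType A) (g : S -> N) :
  exists h : {linear free_module -> N}, forall x, h (fs_delta x 1) = g x.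
Proof.
have lin x : linear ((fun a : A^o => a *: g x) : A^o -> N).
  by move=> a u v; rewrite scalerDl scalerA.
exists (mk_linear (fs_sum_is_linear (fun x => mk_linear (lin x)))) => x /=.
by rewrite fs_sum_delta /= scale1r.
Qed.

Lemma free_ext (N : lmodType A) (h h' : {linear free_module -> N}) :
  (forall x, h (fs_delta x 1) = h' (fs_delta x 1)) -> h =1 h'.
Proof.
move=> hh; apply: fs_ext => x a.
suff -> : fs_delta x a = a *: fs_delta x (1 : A^o).
  change (h (a *: fs_delta x (1 : A^o)) = h' (a *: fs_delta x (1 : A^o))).
  by rewrite !linearZ hh.
apply: fsuppP => y; rewrite fs_funZ !fs_deltaE.
by case: ifP; rewrite ?scaler0 // [_ *: _]mulr1.
Qed.

Lemma free_projective : projective free_module.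
Proof.
move=> N N' g f gs.
have [h hE] := free_lift (fun x => sval (cid (gs (f (fs_delta x 1))))).
exists h => y; apply: (free_ext (h := g \o h) (h' := f)) => x /=.
by rewrite hE; case: cid.
Qed.

End FreeModule.

Section FreeCover.
Variables (A : comNzRingType) (M : lmodType A).

Definition free_cover : {linear free_module A M -> M} :=
  sval (cid (free_lift (fun m : M => m))).

Lemma free_cover_surj y : exists x, free_cover x = y.
Proof. by exists (fs_delta y 1); rewrite /free_cover; case: cid. Qed.

End FreeCover.

Lemma regular_projective (A : comNzRingType) : projective (A^o : lmodType A).
Proof.
move=> N N' g f gs; have [x hx] := gs (f 1).
have lin : linear ((fun a : A^o => a *: x) : A^o -> N).
  by move=> a u v; rewrite scalerDl scalerA.
exists (mk_linear lin) => a /=.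
by rewrite linearZ hx -linearZ [_ *: _]mulr1.
Qed.

Lemma regular2_projective (A : comNzRingType) :
  projective ((A^o * A^o)%type : lmodType A).
Proof.
move=> N N' g f gs; have [x hx] := gs (f (1, 0)); have [y hy] := gs (f (0, 1)).
have lin : linear (fun u : A^o * A^o => u.1 *: x + u.2 *: y).
  by move=> a u v; rewrite !scalerDl scalerDr !scalerA addrACA.
exists (mk_linear lin) => -[a b] /=.
rewrite linearD !linearZ hx hy -!linearZ -linearD; congr (f _).
apply: injective_projections.
  by change (a * 1 + b * 0 = a); rewrite mulr1 mulr0 addr0.
by change (a * 0 + b * 1 = b); rewrite mulr1 mulr0 add0r.
Qed.

(** * Injective modules and Baer's criterion *)

Section Injectivity.
Variable A : comNzRingType.

Definition injective_module (C : lmodType A) : Prop :=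
  forall (U V : lmodType A) (i : {linear U -> V}) (f : {linear U -> C}),
    injective i -> exists g : {linear V -> C}, forall u, g (i u) = f u.

(* A linear map on an ideal I is encoded as a map on A that is linear on I. *)
Definition baer (C : lmodType A) : Prop :=
  forall (I : submodule (A^o : lmodType A)) (f : A -> C),
    (forall a b c, I b -> I c -> f (a * b + c) = a *: f b + f c) ->
    exists c, forall b, I b -> f b = b *: c.

Section BaerCriterion.
Variables (C U V : lmodType A) (i : {linear U -> V}) (f : {linear U -> C}).
Hypotheses (C_baer : baer C) (i_inj : injective i).

Local Open Scope classical_set_scope.

(** Graphs of linear maps from submodules of V to C: for a submodule of V * C, being single-valued
    reduces to the last condition. *)
Definition functional_graph (G : set (V * C)) : Prop :=
  [/\ G (0, 0), forall a x y, G x -> G y -> G (a *: x + y)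
    & forall c, G (0, c) -> c = 0].

Definition base_graph : set (V * C) := [set x | exists u, x = (i u, f u)].

Lemma functional_base : functional_graph base_graph.
Proof.
split=> [|a x y [u ->] [v ->]|c [u [u0 ->]]]; first by exists 0; rewrite !linear0.
  by exists (a *: u + v); rewrite !linearP.
suff -> : u = 0 by rewrite linear0.
by apply: i_inj; rewrite -u0 linear0.
Qed.

Lemma maximal_graph : exists G, [/\ functional_graph G, base_graph `<=` G
  & forall H, functional_graph H -> G `<=` H -> H `<=` G].
Proof.
(* Zorn's lemma also asks for the union of the empty family; adjoining the base graph in the
   predicate makes that case hold. *)
have [F FP Ftot|M [MP Mmax]] :=
  @Zorn_bigcup _ [set G | functional_graph (G `|` base_graph)]; last first.
  exists (M `|` base_graph); split=> // H hH MH.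
  have hHb : H `|` base_graph = H by apply/setUidPl => x bx; apply: MH; right.
  apply: contrapT => HM; apply: (Mmax H); last by rewrite /= hHb.
  split=> [x Mx|HM']; first by apply: MH; left.
  by apply: HM => x /HM'; left.
have key x y : (\bigcup_(X in F) X `|` base_graph) x ->
    (\bigcup_(X in F) X `|` base_graph) y ->
    exists G, [/\ functional_graph G, G x, G y
      & G `<=` \bigcup_(X in F) X `|` base_graph].
  have sub X : F X -> X `|` base_graph `<=` \bigcup_(X in F) X `|` base_graph.
    by move=> FX z [Xz|bz]; [left; exists X|right].
  move=> [[X FX Xx]|bx] [[Y FY Yy]|by_].
  - have [XY|YX] := Ftot X Y FX FY.
      exists (Y `|` base_graph).
      by split; [exact: FP|left; apply: XY|left|exact: sub].
    exists (X `|` base_graph).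
    by split; [exact: FP|left|left; apply: YX|exact: sub].
  - by exists (X `|` base_graph); split; [exact: FP|left|right|exact: sub].
  - by exists (Y `|` base_graph); split; [exact: FP|right|left|exact: sub].
  - exists base_graph.
    by split; [exact: functional_base|by []|by []|by move=> z; right].
split=> [|a x y hx hy|c hc].
- by right; case: functional_base.
- by have [G [[_ GP _] Gx Gy]] := key x y hx hy; apply; apply: GP.
- by have [G [[_ _ GF] Gc _ _]] := key _ _ hc hc; apply: GF.
Qed.

(** A maximal graph G is total: for v in V, the scalars a with a v in the domain of G form an ideal,
    and Baer's condition on it supplies a value c0 that v may take. *)
Lemma baer_extension : exists g : {linear V -> C}, forall u, g (i u) = f u.
Proof.
have [G [[G0 GP GF] bG Gmax]] := maximal_graph.
have Guniq v c c' : G (v, c) -> G (v, c') -> c = c'.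
  move=> h h'; apply/eqP; rewrite -subr_eq0; apply/eqP/GF.
  have := GP (-1) _ _ h' h.
  suff -> : -1 *: (v, c') + (v, c) = (0, c - c') by [].
  by apply: injective_projections => /=; rewrite scaleN1r addrC ?subrr.
have Gtot v : exists c, G (v, c).
  have I0 : exists c, G ((0 : A) *: v, c) by exists 0; rewrite scale0r.
  have IP (a b c : A^o) : (exists x, G ((b : A) *: v, x)) ->
      (exists x, G ((c : A) *: v, x)) ->
      exists x, G ((a *: b + c : A^o) *: v, x).
    move=> [x hx] [y hy]; exists (a *: x + y).
    by have := GP a _ _ hx hy; rewrite /= scalerDl -scalerA.
  pose I : submodule (A^o : lmodType A) :=
    @Submodule A A^o (fun a => exists c, G ((a : A) *: v, c)) I0 IP.
  pose h a := if pselect (exists c, G (a *: v, c)) is left e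
              then sval (cid e) else 0.
  have hP a : I a -> G (a *: v, h a).
    by rewrite /h; case: pselect => // e _; case: cid.
  have [|c0 c0P] := C_baer (I := I) (f := h).
    move=> a b c Ib Ic; apply: Guniq (hP _ (IP _ _ _ Ib Ic)) _.
    have := GP a _ _ (hP _ Ib) (hP _ Ic).
    by rewrite [(a *: b + c) *: v]scalerDl -scalerA.
  exists c0.
  (* H is G + A (v, c0). It stays single-valued because on the ideal I the value at a v is already a
     c0. *)
  pose H : set (V * C) :=
    [set z | exists a, G (z.1 - a *: v, z.2 - a *: c0)].
  apply: (Gmax H); last first.
  - by exists 1; rewrite /= !scale1r !subrr.
  - by move=> [x y] Gxy; exists 0; rewrite /= !scale0r !subr0.
  split=> [|a [x y] [x' y'] [b hb] [b' hb']|c [a /=]].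
  - by exists 0; rewrite /= !scale0r !subr0.
  - exists (a * b + b'); have := GP a _ _ hb hb'; congr G.
    by apply: injective_projections => /=;
      rewrite scalerDl scalerBr scalerA opprD addrACA.
  rewrite sub0r => Gac; have GN : G (a *: v, a *: c0 - c).
    have := GP (-1) _ _ Gac G0; congr G.
    apply: injective_projections => /=;
    by rewrite scaleN1r addr0 ?opprK ?opprB.
  have Ia : I a by exists (a *: c0 - c).
  have := Guniq _ _ _ GN (hP _ Ia); rewrite (c0P _ Ia) => /eqP.
  by rewrite -subr_eq0 addrC addKr oppr_eq0 => /eqP.
pose g v := sval (cid (Gtot v)).
have gP v : G (v, g v) by rewrite /g; case: cid.
have g_lin : linear g by move=> a u v; apply: Guniq (gP _) (GP a _ _ (gP u) (gP v)).
exists (mk_linear g_lin) => u /=; apply: Guniq (gP _) _.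
by apply: bG; exists u.
Qed.

End BaerCriterion.

Theorem baer_injective (C : lmodType A) : baer C -> injective_module C.
Proof. by move=> C_baer U V i f; apply: baer_extension. Qed.

End Injectivity.

(** * Additive maps between vector spaces over F_p *)

Definition exponent (p : nat) (V : zmodType) : Prop := forall v : V, v *+ p = 0.

Section VectorSpaceOverFp.
Variables (p : nat) (p_pr : prime p) (V : zmodType) (Vp : exponent p V).

(** The redex keeps [p_pr] and [Vp] as parameters of the type, so that the scaling, whose laws need
    both, can be attached to it as an instance. *)
Definition Fp_module : Type := (fun (_ : prime p) (_ : exponent p V) => V) p_pr Vp.
HB.instance Definition _ := GRing.Zmodule.on Fp_module.

Lemma mulrn_modn (v : V) n : v *+ (n %% p) = v *+ n.
Proof.
by rewrite {2}(divn_eq n p) mulrnDr mulnC mulrnA Vp mul0rn add0r.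
Qed.

Definition Fp_scale (a : 'F_p) (v : Fp_module) : Fp_module := v *+ (a : nat).

Lemma Fp_scaleA a b v : Fp_scale a (Fp_scale b v) = Fp_scale (a * b) v.
Proof.
rewrite /Fp_scale -mulrnA -[a in RHS]natr_Zp -[b in RHS]natr_Zp -natrM.
by rewrite val_Fp_nat // mulrn_modn mulnC.
Qed.

Lemma Fp_scale1 : left_id 1 Fp_scale.
Proof. by move=> v; rewrite /Fp_scale -[1]/(1%:R) val_Fp_nat // mulrn_modn. Qed.

Lemma Fp_scaleDr : right_distributive Fp_scale +%R.
Proof. by move=> a u v; rewrite /Fp_scale mulrnDl. Qed.

Lemma Fp_scaleDl v : {morph Fp_scale^~ v : a b / a + b}.
Proof.
move=> a b; rewrite /Fp_scale -[a in LHS]natr_Zp -[b in LHS]natr_Zp -natrD.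
by rewrite val_Fp_nat // mulrn_modn mulrnDr.
Qed.

HB.instance Definition _ := GRing.Zmodule_isLmodule.Build 'F_p Fp_module
  Fp_scaleA Fp_scale1 Fp_scaleDr Fp_scaleDl.

End VectorSpaceOverFp.

Lemma field_baer (K : fieldType) (V : lmodType K) : baer V.
Proof.
move=> I f f_lin; have f0 : f 0 = 0.
  have I0 := submodule0 I; have := f_lin 1 _ _ I0 I0.
  by rewrite mulr0 addr0 scale1r => h; apply: (@addrI _ (f 0)); rewrite -h addr0.
have [[a [Ia a0]]|nI] := pselect (exists a : K, I a /\ a != 0).
  exists (a^-1 *: f a) => b Ib; rewrite scalerA.
  have := f_lin (b / a) _ _ Ia (submodule0 I).
  by rewrite divfK // !addr0 f0 addr0.
exists 0 => b Ib; rewrite scaler0.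
suff -> : b = 0 by [].
by apply/eqP/negPn/negP => b0; apply: nI; exists b.
Qed.

Section AdditiveExtension.
Variables (p : nat) (p_pr : prime p).

(** Additive maps between groups of exponent p are linear over F_p, and modules over a field are
    injective. All later splittings rest on this. *)
Theorem additive_extension (U V W : zmodType) (i : {additive U -> V})
    (f : {additive U -> W}) :
  exponent p V -> exponent p W -> injective i ->
  exists g : {additive V -> W}, forall u, g (i u) = f u.
Proof.
move=> Vp Wp i_inj.
have Up : exponent p U.
  by move=> u; apply: i_inj; rewrite raddfMn Vp raddf0.
have lin (X Y : zmodType) (Xp : exponent p X) (Yp : exponent p Y)
    (h : {additive X -> Y}) :
    linear (h : Fp_module p_pr Xp -> Fp_module p_pr Yp).
  by move=> a u v; rewrite raddfD; congr (_ + _); apply: raddfMn.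
have [g gE] := baer_injective (@field_baer _ (Fp_module p_pr Wp))
  (i := mk_linear (lin _ _ Up Vp i)) (mk_linear (lin _ _ Up Wp f)) i_inj.
have gD : {morph (g : V -> W) : x y / x + y} by move=> x y; apply: (raddfD g).
by exists (mk_additive gD).
Qed.

End AdditiveExtension.

Section AdditiveHom.
Variables (A : comNzRingType) (M : lmodType A) (V : zmodType).

Definition ahom_pred : {pred M -> V} :=
  fun f => `[< {morph f : x y / x + y} >].

Lemma ahom_closed : zmod_closed ahom_pred.
Proof.
split=> [|f g /asboolP fD /asboolP gD]; apply/asboolP => x y.
  by change (0 = 0 + 0 :> V); rewrite addr0.
change (f (x + y) - g (x + y) = (f x - g x) + (f y - g y)).
by rewrite fD gD opprD addrACA.
Qed.

HB.instance Definition _ := GRing.isZmodClosed.Build (M -> V) ahom_pred ahom_closed.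

Record ahom := AHom { ahom_val : M -> V; _ : ahom_val \in ahom_pred }.

HB.instance Definition _ := [isSub for ahom_val].
HB.instance Definition _ := [Choice of ahom by <:].
HB.instance Definition _ := [SubChoice_isSubZmodule of ahom by <:].

Definition ahom_app (f : ahom) : M -> V := ahom_val f.

Lemma ahom_appD f : {morph ahom_app f : x y / x + y}.
Proof. by apply/asboolP; case: f. Qed.

Definition ahom_add (f : ahom) : {additive M -> V} := mk_additive (ahom_appD f).

Definition mk_ahom (f : M -> V) (fD : {morph f : x y / x + y}) : ahom :=
  @AHom f (introT (asboolP _) fD).

Lemma ahomP (f g : ahom) : ahom_app f =1 ahom_app g -> f = g.
Proof. by move=> h; apply/val_inj/funext. Qed.

Lemma ahom_scale_subproof a (f : ahom) :
  {morph (fun m => ahom_app f (a *: m)) : x y / x + y}.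
Proof. by move=> x y; rewrite scalerDr ahom_appD. Qed.

(* A acts through the argument; V is a mere abelian group. *)
Definition ahom_scale a f : ahom := mk_ahom (ahom_scale_subproof a f).

Lemma ahom_scaleA a b f : ahom_scale a (ahom_scale b f) = ahom_scale (a * b) f.
Proof.
by apply: ahomP => m; rewrite /ahom_app /= /ahom_app /= scalerA mulrC.
Qed.

Lemma ahom_scale1 : left_id 1 ahom_scale.
Proof. by move=> f; apply: ahomP => m; rewrite {1}/ahom_app /= scale1r. Qed.

Lemma ahom_scaleDr : right_distributive ahom_scale +%R.
Proof. by move=> a f g; apply: ahomP. Qed.

Lemma ahom_scaleDl f : {morph ahom_scale^~ f : a b / a + b}.
Proof.
move=> a b; apply: ahomP => m.
by rewrite {1}/ahom_app /= scalerDl ahom_appD.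
Qed.

HB.instance Definition _ := GRing.Zmodule_isLmodule.Build A ahom
  ahom_scaleA ahom_scale1 ahom_scaleDr ahom_scaleDl.

Lemma ahom_appDl f g m : ahom_app (f + g) m = ahom_app f m + ahom_app g m.
Proof. by []. Qed.

Lemma ahom_appZ a f m : ahom_app (a *: f) m = ahom_app f (a *: m).
Proof. by []. Qed.

Lemma ahom_app0 f : ahom_app f 0 = 0.
Proof. exact: (raddf0 (ahom_add f)). Qed.

Lemma ahom_appB f : {morph ahom_app f : x y / x - y}.
Proof. exact: (raddfB (ahom_add f)). Qed.

Lemma ahom_app0l m : ahom_app 0 m = 0.
Proof. by []. Qed.

Lemma ahom_appBl f g m : ahom_app (f - g) m = ahom_app f m - ahom_app g m.
Proof. by []. Qed.

End AdditiveHom.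

Section AdditiveHomMap.
Variables (A : comNzRingType) (M N : lmodType A) (V : zmodType).
Variable f : {linear M -> N}.

Lemma ahom_map_subproof (h : ahom N V) : {morph (fun m => ahom_app h (f m)) :
  x y / x + y}.
Proof. by move=> x y; rewrite linearD ahom_appD. Qed.

Definition ahom_map_fun (h : ahom N V) : ahom M V :=
  mk_ahom (ahom_map_subproof h).

Lemma ahom_map_is_linear : linear ahom_map_fun.
Proof.
move=> a g h; apply: ahomP => m.
change (ahom_app g (a *: f m) + ahom_app h (f m)
        = ahom_app g (f (a *: m)) + ahom_app h (f m)).
by rewrite linearZ.
Qed.

Definition ahom_map : {linear ahom N V -> ahom M V} :=
  mk_linear ahom_map_is_linear.

Lemma ahom_mapE h m : ahom_app (ahom_map h) m = ahom_app h (f m).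
Proof. by []. Qed.

End AdditiveHomMap.

Section AdditiveHomExact.
Variables (A : comNzRingType) (p : nat) (p_pr : prime p) (V : zmodType).
Hypothesis Vp : exponent p V.
Hypothesis Ap : p%:R = 0 :> A.

Lemma lmod_exponent (M : lmodType A) : exponent p M.
Proof. by move=> m; rewrite -scaler_nat Ap scale0r. Qed.

Lemma ahom_map_surj (M N : lmodType A) (f : {linear M -> N}) :
  injective f -> forall h : ahom M V, exists g, ahom_map V f g = h.
Proof.
move=> f_inj h.
have [g gE] := additive_extension p_pr (i := f) (ahom_add h)
  (lmod_exponent (M := N)) Vp f_inj.
by exists (mk_ahom (raddfD g)); apply: ahomP.
Qed.

Lemma ahom_map_inj (M N : lmodType A) (f : {linear M -> N}) :
  (forall y, exists x, f x = y) -> injective (ahom_map V f).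
Proof.
move=> f_surj g h gh; apply: ahomP => n; have [m <-] := f_surj n.
by rewrite -!ahom_mapE gh.
Qed.

Lemma ahom_map_exact (L M N : lmodType A) (f : {linear L -> M})
    (g : {linear M -> N}) :
  (forall y, exists x, g x = y) -> exact_at f g ->
  exact_at (ahom_map V g) (ahom_map V f).
Proof.
move=> g_surj fg h; split=> [hf|[k <-]]; last first.
  apply: ahomP => l; rewrite !ahom_mapE.
  have -> : g (f l) = 0 by apply/fg; exists l.
  by rewrite ahom_app0.
pose s n := sval (cid (g_surj n)).
have sP n : g (s n) = n by rewrite /s; case: cid.
have hker m : g m = 0 -> ahom_app h m = 0.
  by move=> /fg[l <-]; rewrite -ahom_mapE hf.
have hs m : ahom_app h (s (g m)) = ahom_app h m.
  apply/eqP; rewrite -subr_eq0 -ahom_appB; apply/eqP/hker.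
  by rewrite linearB sP subrr.
have kD : {morph (fun n => ahom_app h (s n)) : x y / x + y}.
  move=> x y; rewrite -ahom_appD -[RHS]hs; congr (ahom_app h (s _)).
  by rewrite linearD !sP.
by exists (mk_ahom kD); apply: ahomP => m; rewrite -[RHS]hs.
Qed.

(* Additive maps P -> ahom U V and U -> ahom P V correspond. *)
Lemma projective_ahom_injective (P : lmodType A) :
  projective P -> injective_module (ahom P V).
Proof.
move=> P_proj U W i f i_inj.
have swapD (X Y : lmodType A) (k : {linear X -> ahom Y V}) y :
    {morph (fun x => ahom_app (k x) y) : u v / u + v}.
  by move=> u v; rewrite linearD.
have swap_lin (X Y : lmodType A) (k : {linear X -> ahom Y V}) :
    linear (fun y => mk_ahom (swapD X Y k y)).
  move=> a y z; apply: ahomP => x; rewrite ahom_appDl ahom_appZ /ahom_app /=.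
  by rewrite -!/(ahom_app _ _) ahom_appD linearZ ahom_appZ.
have [h hE] := P_proj _ _ (ahom_map V i) (mk_linear (swap_lin _ _ f))
  (ahom_map_surj i_inj).
exists (mk_linear (swap_lin _ _ h)) => u; apply: ahomP => q.
by have := congr1 (fun k => ahom_app k u) (hE q).
Qed.

End AdditiveHomExact.

(** * Vanishing of Ext as lifting and extension problems *)

Section Factorization.
Variables (A : comNzRingType) (U V W : lmodType A).

Lemma factor_mono (j : {linear V -> W}) (k : {linear U -> W}) :
  injective j -> (forall u, exists v, j v = k u) ->
  exists h : {linear U -> V}, forall u, j (h u) = k u.
Proof.
move=> j_inj jk; pose h u := sval (cid (jk u)).
have hP u : j (h u) = k u by rewrite /h; case: cid.
have h_lin : linear h by move=> a u v; apply: j_inj; rewrite linearP !hP linearP.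
by exists (mk_linear h_lin).
Qed.

Lemma factor_epi (q : {linear U -> V}) (k : {linear U -> W}) :
  (forall v, exists u, q u = v) -> (forall u, q u = 0 -> k u = 0) ->
  exists h : {linear V -> W}, forall u, h (q u) = k u.
Proof.
move=> q_surj qk; pose s v := sval (cid (q_surj v)).
have sP v : q (s v) = v by rewrite /s; case: cid.
have ks u : k (s (q u)) = k u.
  apply/eqP; rewrite -subr_eq0 -linearB; apply/eqP/qk.
  by rewrite linearB sP subrr.
have h_lin : linear (k \o s).
  by move=> a u v /=; rewrite -linearP -[RHS]ks linearP !sP.
by exists (mk_linear h_lin) => u; apply: ks.
Qed.

End Factorization.

Section LiftingAndExtension.
Variable A : comNzRingType.

Definition lifts (M E C : lmodType A) (e : {linear E -> C}) : Prop :=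
  forall f : {linear M -> C}, exists h : {linear M -> E}, forall m, e (h m) = f m.

Definition extends (K P N : lmodType A) (i : {linear K -> P}) : Prop :=
  forall f : {linear K -> N}, exists g : {linear P -> N}, forall k, g (i k) = f k.

Definition short_exact (L G K : lmodType A) (i : {linear L -> G})
    (q : {linear G -> K}) : Prop :=
  [/\ injective i, forall y, exists x, q x = y & exact_at i q].

Section TwoSequences.
Variables (L G K N E C : lmodType A).
Variables (i : {linear L -> G}) (q : {linear G -> K}).
Variables (j : {linear N -> E}) (e : {linear E -> C}).
Hypotheses (iq : short_exact i q) (je : short_exact j e).

(* Both conditions say that Ext^1(K, N) = 0. *)
Lemma extends_lifts : projective G -> extends N i -> lifts K e.
Proof.
case: iq je => i_inj q_surj iqE [j_inj e_surj jeE] G_proj iN f.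
have [h hE] := G_proj _ _ e (f \o q) e_surj.
have [|phi phiE] := factor_mono (k := h \o i) j_inj.
  move=> l; apply/jeE; rewrite /= hE /=.
  by rewrite (iqE _).2 ?linear0 //; exists l.
have [g gE] := iN phi.
have [|psi psiE] := factor_epi (k := h \- (j \o g)) q_surj.
  by move=> x /iqE[l <-]; rewrite /= gE phiE subrr.
exists psi => k; have [x <-] := q_surj k.
rewrite psiE /= linearB hE /=; have -> : e (j (g x)) = 0 by apply/jeE; exists (g x).
by rewrite subr0.
Qed.

Lemma lifts_extends : injective_module E -> lifts K e -> extends N i.
Proof.
case: iq je => i_inj q_surj iqE [j_inj e_surj jeE] E_inj Ke f.
have [h hE] := E_inj _ _ i (j \o f) i_inj.
have [|psi psiE] := factor_epi (k := e \o h) q_surj.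
  by move=> x /iqE[l <-]; rewrite /= hE; apply/jeE; exists (f l).
have [k kE] := Ke psi.
have [|phi phiE] := factor_mono (k := h \- (k \o q)) j_inj.
  by move=> x; apply/jeE; rewrite /= linearB kE psiE subrr.
exists phi => l; apply: j_inj; rewrite phiE /= hE /=.
have -> : q (i l) = 0 by apply/iqE; exists l.
by rewrite linear0 subr0.
Qed.

(* Both conditions say that Ext^2(K, N) = 0. *)
Lemma extends_lifts_sub : projective G -> extends C i -> lifts L e.
Proof.
case: je => _ e_surj _ G_proj iC f; have [g gE] := iC f.
have [h hE] := G_proj _ _ e g e_surj.
by exists (h \o i) => l /=; rewrite hE gE.
Qed.

Lemma lifts_extends_sub : injective_module E -> lifts L e -> extends C i.
Proof.
case: iq => i_inj _ _ E_inj Le f; have [h hE] := Le f.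
have [g gE] := E_inj _ _ i h i_inj.
by exists (e \o g) => l /=; rewrite gE hE.
Qed.

End TwoSequences.

Lemma short_exact_ker (M N : lmodType A) (f : {linear M -> N}) :
  (forall y, exists x, f x = y) -> short_exact (ker_inj f) f.
Proof. by move=> f_surj; split; [exact: val_inj|by []|exact: exact_ker]. Qed.

(** Cuts a longer exact sequence at the kernel of e, so that dimensions can be shifted one step at a
    time. *)
Lemma short_exact_corestr (K P M N : lmodType A) (i : {linear K -> P})
    (d : {linear P -> M}) (e : {linear M -> N}) :
  injective i -> exact_at i d -> exact_at d e ->
  exists q : {linear P -> ker_type e}, short_exact i q.
Proof.
move=> i_inj id de; have dK x : kernel e (d x) by apply/de; exists x.
exists (corestr dK); split=> //.
  move=> y; have /de[x xE] := submodule_in y.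
  by exists x; apply: val_inj; rewrite -xE.
move=> y; split=> [h|[x <-]].
  by apply/id; have := congr1 (@submodule_inj _ _ _) h; rewrite corestrE linear0.
by apply: val_inj => /=; apply/id; exists x.
Qed.

End LiftingAndExtension.

Section Cosyzygy.
Variables (A : comNzRingType) (p : nat).
Hypotheses (p_pr : prime p) (Ap : p%:R = 0 :> A).

Section Embedding.
Variable N : lmodType A.

(** The coinduced module. It is injective because Hom(-, N) turns the projective module A into an
    injective one, and n |-> (a |-> a n) embeds N into it. *)
Definition coinj_type : lmodType A := ahom (A^o : lmodType A) N.

Lemma coinj_subproof (n : N) : {morph (fun a : A^o => (a : A) *: n) : x y / x + y}.
Proof. by move=> a b; rewrite scalerDl. Qed.

Definition coinj_fun n : coinj_type := mk_ahom (coinj_subproof n).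

Lemma coinj_is_linear : linear coinj_fun.
Proof.
move=> a m n; apply: ahomP => b.
rewrite ahom_appDl ahom_appZ /ahom_app /= scalerDr; congr (_ + _).
by rewrite scalerA; congr (_ *: m); apply: mulrC.
Qed.

Definition coinj : {linear N -> coinj_type} := mk_linear coinj_is_linear.

Lemma coinj_inj : injective coinj.
Proof.
move=> m n /(congr1 (fun h => ahom_app h 1)).
by rewrite /ahom_app /= !scale1r.
Qed.

Lemma coinj_injective : injective_module coinj_type.
Proof.
apply: (projective_ahom_injective p_pr) => //; last exact: regular_projective.
exact: lmod_exponent.
Qed.

Lemma coinj_im0 : exists n, coinj n = 0.
Proof. by exists 0; rewrite linear0. Qed.

Lemma coinj_imP a u v : (exists n, coinj n = u) -> (exists n, coinj n = v) ->
  exists n, coinj n = a *: u + v.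
Proof. by move=> [m <-] [n <-]; exists (a *: m + n); rewrite linearP. Qed.

Definition coinj_image : submodule coinj_type := @Submodule A coinj_type
  (fun u => exists n, coinj n = u) coinj_im0 coinj_imP.

Definition cosyz : lmodType A := quot_module coinj_image.

Definition cosyz_pi : {linear coinj_type -> cosyz} := quot_pi coinj_image.

Lemma cosyz_exact : short_exact coinj cosyz_pi.
Proof.
split; [exact: coinj_inj|exact: quot_pi_surj|].
by move=> y; apply: quot_pi0.
Qed.

End Embedding.

(* Ext^(n+1)(M, N) = 0 *)
Definition ext_zero n (M N : lmodType A) : Prop :=
  lifts M (cosyz_pi (iter n cosyz N)).

(** Both sides amount to extending maps into the next cosyzygy along i: P is projective, which
    serves one direction of each comparison, and coinduced modules are injective, which serves the
    other. *)
Lemma ext_zero_shift n (K P M : lmodType A) (i : {linear K -> P})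
    (q : {linear P -> M}) (N : lmodType A) :
  short_exact i q -> projective P -> ext_zero n K N <-> ext_zero n.+1 M N.
Proof.
move=> iq P_proj; pose N' := iter n cosyz N.
split=> h.
  apply: (extends_lifts iq (cosyz_exact (cosyz N'))) => //.
  apply: (lifts_extends_sub (e := cosyz_pi N') iq) => //; exact: coinj_injective.
apply: (extends_lifts_sub (i := i) (cosyz_exact N')) => //.
apply: (lifts_extends iq (cosyz_exact (cosyz N'))) => //; exact: coinj_injective.
Qed.

Lemma ext_zero_shift2 n (K P1 P0 M : lmodType A) (i : {linear K -> P1})
    (d : {linear P1 -> P0}) (e : {linear P0 -> M}) (N : lmodType A) :
  injective i -> exact_at i d -> exact_at d e -> (forall y, exists x, e x = y) ->
  projective P1 -> projective P0 -> ext_zero n K N <-> ext_zero n.+2 M N.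
Proof.
move=> i_inj id de e_surj P1_proj P0_proj.
have [q iq] := short_exact_corestr i_inj id de.
rewrite (ext_zero_shift n N iq P1_proj).
exact: (ext_zero_shift _ _ (short_exact_ker e_surj)).
Qed.

Lemma ext_zero_injective n (M N : lmodType A) :
  injective_module (iter n cosyz N) -> ext_zero n M N.
Proof.
move=> N_inj; have cov := short_exact_ker (free_cover_surj (M := M)).
apply: (extends_lifts cov (cosyz_exact _)); first exact: free_projective.
by move=> f; apply: N_inj; case: cov.
Qed.

Lemma ext_zero_projective_mod n (M N : lmodType A) :
  projective M -> ext_zero n M N.
Proof. by move=> M_proj f; apply: M_proj; apply: quot_pi_surj. Qed.

(** The hypothesis is used for N the kernel of g. A free cover of M trades its embedding into a
    coinduced module for its embedding into X. *)
Lemma projective_ext_zero (M : lmodType A) :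
  (forall N, ext_zero 0 M N) -> projective M.
Proof.
move=> M0 X Y g f g_surj.
have cov := short_exact_ker (free_cover_surj (M := M)).
apply: (extends_lifts cov (short_exact_ker g_surj)); first exact: free_projective.
apply: (lifts_extends cov (cosyz_exact _)); last exact: M0.
exact: coinj_injective.
Qed.

End Cosyzygy.

(** * Functionals on tensor products and flatness by duality *)

Section TensorFunctionals.
Variables (A : comNzRingType) (M N : lmodType A).

Lemma pure_tensorDl m m' n :
  pure_tensor (m + m') n = pure_tensor m n + pure_tensor m' n :> tensor M N.
Proof.
rewrite [RHS](tadd_pi [:: (m, n)] [:: (m', n)]).
exact/tensor_classP/TensorAddl.
Qed.

Lemma pure_tensorDr m n n' :
  pure_tensor m (n + n') = pure_tensor m n + pure_tensor m n' :> tensor M N.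
Proof.
rewrite [RHS](tadd_pi [:: (m, n)] [:: (m, n')]).
exact/tensor_classP/TensorAddr.
Qed.

Lemma pure_tensorZ a m n :
  pure_tensor (a *: m) n = pure_tensor m (a *: n) :> tensor M N.
Proof. exact/tensor_classP/TensorScale. Qed.

Lemma tensor_ext (W : zmodType) (h h' : {additive tensor M N -> W}) :
  (forall m n, h (pure_tensor m n) = h' (pure_tensor m n)) -> h =1 h'.
Proof.
move=> hh; elim/tensorW; elim=> [|[m n] s IHs].
  exact: etrans (raddf0 h) (esym (raddf0 h')).
have -> : tensor_class ((m, n) :: s) = pure_tensor m n + tensor_class s.
  exact: esym (tadd_pi [:: (m, n)] s).
by rewrite !raddfD hh IHs.
Qed.

Variable W : zmodType.

(** W carries no A-structure, so the universal property is applied with values in the coinduced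
    module Hom(A, W), and evaluation at 1 comes back to W. *)
Lemma ahom_tensor (g : {linear N -> ahom M W}) :
  exists h : {additive tensor M N -> W},
    forall m n, h (pure_tensor m n) = ahom_app (g n) m.
Proof.
have bD m n : {morph (fun a : A^o => ahom_app (g n) ((a : A) *: m)) : x y / x + y}.
  by move=> a b; rewrite scalerDl ahom_appD.
pose b m n : ahom (A^o : lmodType A) W := mk_ahom (bD m n).
have bl n : linear (b^~ n).
  move=> a m m'; apply: ahomP => c.
  rewrite ahom_appDl ahom_appZ /b /ahom_app /= -!/(ahom_app _ _).
  rewrite scalerDr ahom_appD scalerA; congr (ahom_app _ (_ *: m) + _).
  exact: mulrC.
have br m : linear (b m).
  move=> a n n'; apply: ahomP => c.
  rewrite ahom_appDl ahom_appZ /b /ahom_app /= -!/(ahom_app _ _).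
  rewrite linearD ahom_appDl linearZ ahom_appZ scalerA; congr (_ + _).
have [h [[h_lin hE] _]] := tensor_universal bl br.
have hD : {morph (fun z => ahom_app (h z) 1) : x y / x + y}.
  by move=> x y; have := h_lin 1 x y; rewrite !scale1r => ->.
exists (mk_additive hD) => m n /=.
by rewrite hE /b /ahom_app /= scale1r.
Qed.

Lemma tensor_ahom (h : {additive tensor M N -> W}) :
  exists g : {linear N -> ahom M W},
    forall m n, ahom_app (g n) m = h (pure_tensor m n).
Proof.
have gD n : {morph (fun m => h (pure_tensor m n)) : x y / x + y}.
  by move=> x y; rewrite pure_tensorDl raddfD.
have g_lin : linear (fun n => mk_ahom (gD n)).
  move=> a n n'; apply: ahomP => m.
  rewrite ahom_appDl ahom_appZ /ahom_app /=.
  by rewrite pure_tensorDr raddfD pure_tensorZ.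
by exists (mk_linear g_lin).
Qed.

End TensorFunctionals.

Section Duality.
Variables (A : comNzRingType) (p : nat).
Hypotheses (p_pr : prime p) (Ap : p%:R = 0 :> A).

Lemma Fp_exponent : exponent p 'F_p.
Proof. by move=> a; rewrite -mulr_natr pchar_Fp_0 // mulr0. Qed.

(** The line spanned by v is a copy of F_p; its coordinate extends to V. *)
Lemma separating_functional (V : zmodType) (v : V) :
  exponent p V -> v <> 0 -> exists h : {additive V -> 'F_p}, h v <> 0.
Proof.
move=> Vp v0; have iD : {morph (fun a : 'F_p => v *+ (a : nat)) : a b / a + b}.
  exact: (Fp_scaleDl (p_pr := p_pr) (Vp := Vp)).
have i_inj : injective (mk_additive iD).
  move=> a b /eqP; rewrite -subr_eq0 -raddfB => ab.
  apply/eqP; rewrite -subr_eq0; apply/negPn/negP => c0; apply: v0.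
  set c := a - b in ab c0.
  have := Fp_scaleA (p_pr := p_pr) (Vp := Vp) c^-1 c v.
  rewrite mulVf // Fp_scale1 => <-.
  by rewrite /Fp_scale (eqP ab : v *+ c = 0) mul0rn.
have [h hE] := additive_extension p_pr (i := mk_additive iD) (@idfun 'F_p)
  Vp Fp_exponent i_inj.
exists h; have := hE 1; rewrite /= mulr1n => -> /eqP.
by rewrite oner_eq0.
Qed.

Definition dual (M : lmodType A) : lmodType A := ahom M 'F_p.

(** A nonzero z in the kernel would be detected by a functional on the tensor product. Such a
    functional is a linear map N -> [dual M], which extends along f, so it factors through
    [tensor_map f] and kills z. *)
Lemma dual_injective_flat (M : lmodType A) : injective_module (dual M) -> flat M.
Proof.
move=> M_inj N N' f f_inj.
suff ker0 z : @tensor_map A M N N' f z = 0 -> z = 0.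
  move=> x y xy; apply/eqP; rewrite -subr_eq0; apply/eqP/ker0.
  by rewrite linearB; apply/eqP; rewrite subr_eq0; apply/eqP.
move=> fz; apply: contrapT => z0.
have [h hz] := separating_functional (lmod_exponent Ap (M := tensor M N)) z0.
have [g gE] := tensor_ahom h.
have [g' g'E] := M_inj _ _ f g f_inj.
have [h' h'E] := ahom_tensor g'.
apply: hz; rewrite -(raddf0 h') -fz.
apply: (tensor_ext (h := h) (h' := h' \o tensor_map f)) => m n /=.
by rewrite tensor_map_pure h'E g'E gE.
Qed.

Lemma flat_dual_injective (M : lmodType A) : flat M -> injective_module (dual M).
Proof.
move=> M_flat N N' f g f_inj.
have [h hE] := ahom_tensor g.
have [h' h'E] := additive_extension p_pr (i := tensor_map f) h
  (lmod_exponent Ap (M := tensor M N')) Fp_exponent (M_flat _ _ f f_inj).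
have [g' g'E] := tensor_ahom h'.
exists g' => n; apply: ahomP => m.
by rewrite g'E -hE -h'E; congr (h' _); apply/esym/tensor_map_pure.
Qed.

Lemma projective_flat (M : lmodType A) : projective M -> flat M.
Proof.
move=> M_proj; apply: dual_injective_flat.
exact: (projective_ahom_injective p_pr Fp_exponent Ap).
Qed.

Lemma dual_short_exact (L M N : lmodType A) (i : {linear L -> M})
    (q : {linear M -> N}) :
  short_exact i q -> short_exact (ahom_map 'F_p q) (ahom_map 'F_p i).
Proof.
move=> [i_inj q_surj iq]; split.
- exact: ahom_map_inj.
- by apply: (ahom_map_surj p_pr Fp_exponent Ap).
- exact: ahom_map_exact.
Qed.

End Duality.

Section Resolutions.
Variable A : comNzRingType.

Lemma has_resolution0 (C : lmodType A -> Prop) (M : lmodType A) :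
  C ('rV[A]_0 : lmodType A) -> C M -> has_resolution C M 0.
Proof.
move=> C0 CM; have rV0 (x : 'rV[A]_0) : x = 0 by apply/rowP => -[].
pose P i : lmodType A := if i is _.+1 then 'rV[A]_0 else M.
exists P, (fun i => (\0 : {linear P i.+1 -> P i})), (@idfun M); split.
- by case.
- by case.
- by move=> y; exists y.
- by move=> y; split=> [/= ->|[x <-]] //; exists 0.
- by move=> i y; split=> // _; exists 0; rewrite [RHS]rV0.
Qed.

Lemma has_resolutionS (C : lmodType A -> Prop) (K P M : lmodType A) n
    (i : {linear K -> P}) (q : {linear P -> M}) :
  short_exact i q -> C P -> has_resolution C K n -> has_resolution C M n.+1.
Proof.
move=> [i_inj q_surj iq] CP [F [d [e [CF F0 e_surj de dd]]]].
pose F' j : lmodType A := if j is j'.+1 then F j' else P.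
pose d' j : {linear F' j.+1 -> F' j} :=
  match j return {linear F' j.+1 -> F' j} with
  | 0 => i \o e | j'.+1 => d j' end.
exists F', d', q; split=> //.
- by case.
- by case.
- move=> y; split=> [/iq[k <-]|[x <-]]; last by apply/iq; exists (e x).
  by have [x <-] := e_surj k; exists x.
- case=> [|j] //= y; rewrite -[X in _ <-> X]de /=; split=> [|->].
    by rewrite -(linear0 i) => /i_inj.
  by rewrite linear0.
Qed.

End Resolutions.

(** * Dimensions of glued rings *)

Section MittagLeffler.
Variable A : comNzRingType.

(* Vanishing of lim^1 for the towers of multiplications on N. *)
Definition telescoping (N : lmodType A) : Prop :=
  forall (a : nat -> A) (e : nat -> N),
    exists w : nat -> N, forall n, w n - a n *: w n.+1 = e n.

Lemma telescoping_quotient (E C : lmodType A) (q : {linear E -> C}) :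
  (forall y, exists x, q x = y) -> telescoping E -> telescoping C.
Proof.
move=> q_surj EM a e; pose s y := sval (cid (q_surj y)).
have sP y : q (s y) = y by rewrite /s; case: cid.
have [w wE] := EM a (s \o e).
by exists (q \o w) => n /=; rewrite -linearZ -linearB wE /= sP.
Qed.

(** A solution w is an additive map h on the direct sum of copies of M, with h o T given by e, where
    T sends m in place n to m in place n minus a_n m in place n + 1. T is injective, its kernel
    vanishing place by place, so h exists by additive extension. *)
Lemma telescoping_ahom p (M : lmodType A) (V : zmodType) :
  prime p -> p%:R = 0 :> A -> exponent p V -> telescoping (ahom M V).
Proof.
move=> p_pr Ap Vp a e.
have sD n : {morph (fun m : M => fs_delta n m - fs_delta n.+1 (a n *: m)) :
    x y / x + y}.
  move=> x y; apply: fsuppP => k; rewrite !fs_funD -!scaleN1r !fs_funZ !fs_deltaE.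
  by case: ifP; case: ifP; rewrite ?scaler0 ?addr0 ?add0r ?scalerDr // addrACA.
pose T : {additive fsupp nat M -> fsupp nat M} :=
  mk_additive (fs_sumD (fun n => mk_additive (sD n))).
pose pr n : {additive fsupp nat M -> M} :=
  @mk_additive _ _ (fun f => fs_fun f n) (fun f g => fs_funD f g n).
pose sc b : {additive M -> M} := mk_additive (fun x y : M => scalerDr b x y).
have Td n m : T (fs_delta n m) = fs_delta n m - fs_delta n.+1 (a n *: m).
  exact: fs_sum_delta.
have subE (f g : fsupp nat M) k : fs_fun (f - g) k = fs_fun f k - fs_fun g k.
  by [].
have T0 f : fs_fun (T f) 0 = fs_fun f 0.
  apply: (fs_ext (h := pr 0 \o T) (h' := pr 0)) => n m.
  change (fs_fun (T (fs_delta n m)) 0 = fs_fun (fs_delta n m) 0).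
  by rewrite Td subE !fs_deltaE subr0.
have TS f n : fs_fun (T f) n.+1 = fs_fun f n.+1 - a n *: fs_fun f n.
  apply: (fs_ext (h := pr n.+1 \o T) (h' := pr n.+1 \- (sc (a n) \o pr n))) => k m.
  change (fs_fun (T (fs_delta k m)) n.+1
    = fs_fun (fs_delta k m) n.+1 - a n *: fs_fun (fs_delta k m) n).
  rewrite Td subE !fs_deltaE eqSS.
  congr (_ - _).
  have [<-|nk] := eqVneq n k; first by [].
  by rewrite scaler0.
have T_inj : injective T.
  move=> f g /eqP; rewrite -subr_eq0 -raddfB => /eqP Tfg.
  apply/eqP; rewrite -subr_eq0; apply/eqP; move: (f - g) Tfg => {f g} f Tf.
  apply: fsuppP; elim=> [|n IHn]; first by rewrite -T0 Tf.
  by have := TS f n; rewrite Tf IHn scaler0 subr0.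
have [h hE] := additive_extension p_pr (i := T)
  (mk_additive (fs_sumD (fun n => ahom_add (e n))))
  (lmod_exponent Ap (M := fsupp nat M)) Vp T_inj.
have wD n : {morph (fun m => h (fs_delta n m)) : x y / x + y}.
  move=> x y; rewrite -raddfD; congr (h _); apply: fsuppP => k.
  by rewrite fs_funD !fs_deltaE; case: ifP; rewrite ?addr0.
exists (fun n => mk_ahom (wD n)) => n; apply: ahomP => m.
change (h (fs_delta n m) - h (fs_delta n.+1 (a n *: m)) = ahom_app (e n) m).
by rewrite -raddfB -Td hE /= fs_sum_delta.
Qed.

End MittagLeffler.

(** * Maps on increasing unions of principal ideals *)

Section ChainExtension.
Variable A : comNzRingType.

Lemma injective_baer (E : lmodType A) : injective_module E -> baer E.
Proof.
move=> E_inj I f f_lin.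
have h_lin : linear (fun b : submodule_type I => f (submodule_inj I b)).
  move=> a b c; rewrite linearP.
  by apply: f_lin; apply: submodule_in.
have [g gE] := E_inj _ _ (submodule_inj I) (mk_linear h_lin)
  (@submodule_inj_inj _ _ _).
exists (g 1) => b Ib.
have /= <- := gE (submodule_elt (S := I) Ib).
by rewrite -linearZ [_ *: _]mulr1.
Qed.

(** An increasing sequence of principal ideals A d_n with regular generators: each is free of rank
    1, and their union is the colimit of copies of A under the multiplications by a_n. *)
Record chain (d a : nat -> A) : Prop := Chain {
  chainE : forall n, d n = a n * d n.+1;
  chain_reg : forall n b, b * d n = 0 -> b = 0 }.

Lemma chain_common d a b b' : chain d a ->
  (exists n k, b = k * d n) -> (exists n k, b' = k * d n) ->
  exists n k k', b = k * d n /\ b' = k' * d n.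
Proof.
move=> [dE _] [n [k ->]] [m [k' ->]].
have up i j : exists b, d i = b * d (i + j)%N.
  elim: j => [|j [u hu]]; first by exists 1; rewrite addn0 mul1r.
  by exists (u * a (i + j)%N); rewrite addnS -mulrA -dE.
have [u uE] := up n m; have [v vE] := up m n; rewrite addnC in vE.
by exists (n + m)%N, (k * u), (k' * v); rewrite -!mulrA -uE -vE.
Qed.

Lemma chain_ideal0 (d : nat -> A) : exists n k, 0 = k * d n.
Proof. by exists 0%N, 0; rewrite mul0r. Qed.

Section ChainMap.
Variables (d a : nat -> A).
Hypothesis da : chain d a.

Lemma chain_idealP (b : A) (u v : A^o) : (exists n k, u = k * d n) ->
  (exists n k, v = k * d n) -> exists n k, b *: u + v = k * d n.
Proof.
move=> hu hv; have [n [k [l [-> ->]]]] := chain_common da hu hv.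
by exists n, (b * k + l); rewrite mulrDl -mulrA.
Qed.

Definition chain_ideal : submodule (A^o : lmodType A) :=
  @Submodule A A^o (fun b => exists n k, b = k * d n) (chain_ideal0 d) chain_idealP.

(** Regularity of the d_n makes k d_n |-> k y_n well defined on the union. The map is given on all
    of A, with value 0 off the ideal, to fit the form of [baer]. *)
Lemma chain_map (M : lmodType A) (y : nat -> M) :
  (forall n, y n = a n *: y n.+1) ->
  exists g : A -> M, (forall n k, g (k * d n) = k *: y n) /\
    forall b u v, chain_ideal u -> chain_ideal v -> g (b * u + v) = b *: g u + g v.
Proof.
move=> yE; have [dE d_reg] := da.
have yup i j : exists b, d i = b * d (i + j)%N /\ y i = b *: y (i + j)%N.
  elim: j => [|j [u [hu hy]]]; first by exists 1; rewrite addn0 mul1r scale1r.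
  by exists (u * a (i + j)%N); rewrite addnS -mulrA -dE -scalerA -yE.
have y_uniq n m k l : k * d n = l * d m -> k *: y n = l *: y m.
  have [u [du ->]] := yup n m; have [v [dv ->]] := yup m n.
  rewrite du dv [(m + n)%N]addnC !mulrA => /eqP.
  rewrite -subr_eq0 -mulrBl => /eqP/d_reg/eqP; rewrite subr_eq0 => /eqP kl.
  by rewrite !scalerA kl.
pose g b := if pselect (exists n k, b = k * d n) is left e
  then sval (cid (svalP (cid e))) *: y (sval (cid e)) else 0.
have gE n k : g (k * d n) = k *: y n.
  rewrite /g; case: pselect => [e|[]]; last by exists n, k.
  by case: cid => m /= hm; case: cid => l /= /esym; apply: y_uniq.
exists g; split=> // b u v hu hv.
have [n [k [l [-> ->]]]] := chain_common da hu hv.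
by rewrite mulrA -mulrDl !gE scalerDl scalerA.
Qed.

Lemma chain_extend (E : lmodType A) (z : nat -> E) :
  injective_module E -> (forall n, z n = a n *: z n.+1) ->
  exists x, forall n, z n = d n *: x.
Proof.
move=> E_inj zE; have [g [gE g_lin]] := chain_map zE.
have [x xP] := injective_baer E_inj g_lin.
exists x => n; rewrite -xP; last by exists n, 1; rewrite mul1r.
by rewrite -[d n]mul1r gE scale1r.
Qed.

End ChainMap.

(* Ext^1(U, N) is the lim^1 of a tower on N, for U the union of the A d_n. *)
Lemma chain_lift (N E C : lmodType A) (j : {linear N -> E}) (e : {linear E -> C})
    (d a : nat -> A) (y : nat -> C) :
  short_exact j e -> injective_module E -> telescoping N -> chain d a ->
  (forall n, y n = a n *: y n.+1) -> exists x, forall n, y n = d n *: e x.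
Proof.
move=> [j_inj e_surj je] E_inj NM da yE.
pose s x := sval (cid (e_surj x)).
have sP x : e (s x) = x by rewrite /s; case: cid.
have uP n : exists u, j u = s (y n) - a n *: s (y n.+1).
  by apply/je; rewrite linearB linearZ /= !sP -yE subrr.
pose u n := sval (cid (uP n)).
have uE n : j (u n) = s (y n) - a n *: s (y n.+1) by rewrite /u; case: cid.
have [w wE] := NM a u.
have ej v : e (j v) = 0 by apply/je; exists v.
have [n|x xE] := chain_extend da (z := fun n => s (y n) - j (w n)) E_inj.
  have jw : j (w n) = s (y n) - a n *: s (y n.+1) + a n *: j (w n.+1).
    by rewrite -uE -linearZ -linearD -wE subrK.
  by rewrite jw scalerBr opprD addrA subKr.
exists x => n; rewrite -linearZ -xE.
by rewrite linearB sP ej subr0.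
Qed.

End ChainExtension.

Section AdditiveSection.
Variables (A : comNzRingType) (p : nat).
Hypotheses (p_pr : prime p) (Ap : p%:R = 0 :> A).

(** The kernel of q has an additive retraction r, and x - r x depends only on q x. *)
Lemma additive_section (X Y : lmodType A) (q : {linear X -> Y}) :
  (forall y, exists x, q x = y) ->
  exists s : {additive Y -> X}, forall y, q (s y) = y.
Proof.
move=> q_surj.
have [r rE] := additive_extension p_pr (i := ker_inj q) (@idfun (ker_type q))
  (lmod_exponent Ap (M := X)) (lmod_exponent Ap (M := ker_type q)) (@val_inj _ _ _).
pose t y := sval (cid (q_surj y)).
have tP y : q (t y) = y by rewrite /t; case: cid.
pose g x := x - ker_inj q (r x).
have gB x x' : g (x - x') = g x - g x'.
  have rB : ker_inj q (r (x - x')) = ker_inj q (r x) - ker_inj q (r x').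
    by rewrite !raddfB.
  by rewrite /g rB !opprB addrACA [RHS]addrACA [- x' + _]addrC.
have g_ker x x' : q x = q x' -> g x = g x'.
  move=> qx; apply/eqP; rewrite -subr_eq0 -gB.
  have [z <-] : exists z, ker_inj q z = x - x'.
    by apply/exact_ker; rewrite linearB qx subrr.
  by rewrite /g rE subrr.
have qg x : q (g x) = q x.
  rewrite /g linearB; have -> : q (ker_inj q (r x)) = 0.
    by apply/exact_ker; exists (r x).
  by rewrite subr0.
have sD : {morph (g \o t) : y z / y + z}.
  move=> y z; apply/eqP; rewrite -subr_eq -gB; apply/eqP.
  by apply: g_ker; rewrite linearB !tP addrK.
by exists (mk_additive sD) => y /=; rewrite qg tP.
Qed.

End AdditiveSection.

(* Models k + J inside a Bezout domain B, where k is the prime field and J an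
   ideal of B: J is the union of the A c_n, and for every ideal I the product
   J I lies in an increasing union of principal ideals A d_n contained in I. *)
Record glued_ring (A : comNzRingType) (J : submodule (A^o : lmodType A))
    (c a : nat -> A) : Prop := GluedRing {
  glued_chain : chain c a;
  gluedJ : forall b, J b <-> exists n d, b = d * c n;
  glued_residue : forall b, exists k, J (b - k%:R);
  glued_ideal : forall I : submodule (A^o : lmodType A),
    (exists2 b, I b & b <> 0) ->
    exists d a' : nat -> A, [/\ chain d a', forall n, I (d n)
      & forall i j, I i -> J j -> exists n b, j * i = b * d n] }.

(** * Upper bounds: injectivity of a second cosyzygy *)

Section UpperBounds.
Variables (A : comNzRingType) (p : nat).
Hypotheses (p_pr : prime p) (Ap : p%:R = 0 :> A).
Variables (J : submodule (A^o : lmodType A)) (c a : nat -> A).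
Hypothesis AJ : glued_ring J c a.

Section DoubleCosyzygy.
Variables (N E0 C1 E1 C2 : lmodType A).
Variables (j0 : {linear N -> E0}) (e0 : {linear E0 -> C1}).
Variables (j1 : {linear C1 -> E1}) (e1 : {linear E1 -> C2}).
Hypotheses (j0e0 : short_exact j0 e0) (j1e1 : short_exact j1 e1).
Hypotheses (E0_inj : injective_module E0) (E1_inj : injective_module E1).
Hypotheses (N_tel : telescoping N) (E0_tel : telescoping E0).

Section Torsion.
Variable M : lmodType A.

(** The copy of Hom(A / J, M) inside M. *)
Definition torsion_pred (m : M) : Prop := forall b : A, J b -> b *: m = 0.

Lemma torsion0 : torsion_pred 0.
Proof. by move=> b _; rewrite scaler0. Qed.

Lemma torsionP d u v : torsion_pred u -> torsion_pred v ->
  torsion_pred (d *: u + v).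
Proof.
move=> hu hv b Jb; rewrite scalerDr hv // addr0 scalerA mulrC -scalerA hu //.
by rewrite scaler0.
Qed.

Definition torsion : submodule M := Submodule torsion0 torsionP.

End Torsion.

Arguments torsion {M}.

(* A lift z of y gives a map J -> C1, b |-> b z; as Ext^1(J, N) = 0, it lifts to
   E0, so it is the multiplication by an element of C1. *)
Lemma torsion_surj (y : C2) : torsion y -> exists2 x, torsion x & e1 x = y.
Proof.
case: (AJ) => ca JE _ _ hy; have [j1_inj e1_surj je1] := j1e1.
have [z zy] := e1_surj y.
have uP n : exists u, j1 u = c n *: z.
  apply/je1; rewrite linearZ /= zy; apply: hy; apply/JE.
  by exists n, 1; rewrite mul1r.
pose u n := sval (cid (uP n)).
have uE n : j1 (u n) = c n *: z by rewrite /u; case: cid.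
have [n|x xE] := chain_lift (y := u) j0e0 E0_inj N_tel ca.
  by apply: j1_inj; rewrite linearZ /= !uE scalerA -(chainE ca).
exists (z - j1 (e0 x)); last first.
  rewrite linearB zy; have -> : e1 (j1 (e0 x)) = 0 by apply/je1; exists (e0 x).
  by rewrite subr0.
move=> b /JE[n [d ->]]; rewrite -scalerA scalerBr -linearZ.
by rewrite -[c n *: e0 x]xE uE subrr scaler0.
Qed.

(** Lifting of torsion elements by torsion elements can be made additive. This is as good as linear,
    since A acts on the torsion through integers; outside the torsion s is set to 0. *)
Lemma torsion_section : exists s : C2 -> E1,
  [/\ forall y, torsion y -> torsion (s y), forall y, torsion y -> e1 (s y) = y
    & forall y z, torsion y -> torsion z -> s (y + z) = s y + s z].
Proof.
have qP (x : submodule_type (@torsion E1)) :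
    @torsion C2 ((e1 \o submodule_inj _) x).
  by move=> b Jb; rewrite /= -linearZ (submodule_in x) // linear0.
have q_surj y : exists x, corestr qP x = y.
  have [x hx xy] := torsion_surj (submodule_in y).
  by exists (submodule_elt hx); apply: val_inj; rewrite /= xy.
have [s sE] := additive_section p_pr Ap q_surj.
pose s' y := if pselect (@torsion C2 y) is left h
  then submodule_inj (@torsion E1) (s (submodule_elt h)) else 0.
have s'E y (h : @torsion C2 y) : s' y = submodule_inj _ (s (submodule_elt h)).
  rewrite /s'; case: pselect => // h'; congr (submodule_inj _ (s _)).
  exact: val_inj.
exists s'; split=> [y hy|y hy|y z hy hz].
- by rewrite (s'E y hy); apply: (submodule_in (s (submodule_elt hy))).
- rewrite (s'E y hy); have := sE (submodule_elt hy).
  by move/(congr1 (@submodule_inj _ _ _)); rewrite corestrE.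
- rewrite (s'E y hy) (s'E z hz) (s'E _ (submoduleD hy hz)) -linearD -raddfD.
  by congr (submodule_inj _ (s _)); apply: val_inj.
Qed.

(** Baer's criterion in two corrections. The union of the A d_n contains J I, and since lim^1
    vanishes on C1, a quotient of E0, the map f agrees there with multiplication by some e1 x1. The
    difference g kills J I, so it takes torsion values; composed with the section s it becomes a
    linear map into E1, hence multiplication by some x2. *)
Lemma double_cosyzygy_injective : injective_module C2.
Proof.
case: (AJ) => _ _ _ ideal_chain; have [j1_inj e1_surj je1] := j1e1.
apply: baer_injective => I f f_lin.
have f0 : f 0 = 0.
  have := f_lin 1 0 0 (submodule0 I) (submodule0 I).
  by rewrite mulr0 addr0 scale1r => h; apply: (@addrI _ (f 0)); rewrite -h addr0.
have fZ b d : I d -> f (b * d) = b *: f d.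
  move=> Id; have := f_lin b _ _ Id (submodule0 I).
  by rewrite addr0 f0 addr0.
have [I0|I0] := pselect (exists2 b, I b & b <> 0); last first.
  exists 0 => b Ib; rewrite scaler0; have [-> //|b0] := eqVneq b 0.
  by case: I0; exists b => //; apply/eqP.
have [d [a' [da Id JI]]] := ideal_chain I I0.
have C1_tel : telescoping C1.
  by apply: telescoping_quotient E0_tel; case: j0e0.
have [n|x1 x1E] := chain_lift (y := f \o d) j1e1 E1_inj C1_tel da.
  by rewrite /= -fZ // -(chainE da).
pose g b := f b - b *: e1 x1.
have g_tors b : I b -> torsion (g b).
  move=> Ib k Jk; have [n [l kb]] := JI b k Ib Jk.
  rewrite /g scalerBr -fZ // scalerA kb fZ // -scalerA.
  by rewrite -[d n *: _]x1E subrr.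
have g_lin b u v : I u -> I v -> g (b * u + v) = b *: g u + g v.
  move=> Iu Iv; rewrite /g f_lin // scalerDl scalerBr scalerA.
  by rewrite opprD addrACA.
have [s [s_tors sK sD]] := torsion_section.
have sM y k : torsion y -> s (y *+ k) = s y *+ k.
  move=> hy; have hyk m : torsion (y *+ m).
    by rewrite -scaler_nat; apply: submoduleZ.
  have s0 : s 0 = 0.
    have := sD _ _ (torsion0 C2) (torsion0 C2); rewrite addr0 => h.
    by apply: (@addrI _ (s 0)); rewrite -h addr0.
  elim: k => [|k IHk]; first by rewrite !mulr0n.
  by rewrite !mulrS sD // IHk.
have [|x2 x2E] := injective_baer E1_inj (I := I) (f := s \o g).
  move=> b u v Iu Iv; rewrite /= g_lin // sD; last exact: g_tors.
    congr (_ + _).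
    (* A acts on the torsion through A / J, which is a quotient of nat. *)
    have [m mP] := glued_residue AJ b.
    have scal (M : lmodType A) (y : M) : torsion y -> b *: y = y *+ m.
      by move=> hy; rewrite -(subrK m%:R b) scalerDl hy // add0r scaler_nat.
    rewrite !scal; [exact/sM/g_tors|exact/s_tors/g_tors|exact: g_tors].
  by apply: submoduleZ; apply: g_tors.
exists (e1 (x1 + x2)) => b Ib.
have e1x2 : b *: e1 x2 = g b.
  by rewrite -linearZ -x2E //= sK //; apply: g_tors.
by rewrite linearD scalerDr e1x2 /g addrC subrK.
Qed.

End DoubleCosyzygy.
End UpperBounds.

Section Bounds.
Variables (A : comNzRingType) (p : nat).
Hypotheses (p_pr : prime p) (Ap : p%:R = 0 :> A).
Variables (J : submodule (A^o : lmodType A)) (c a : nat -> A).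
Hypothesis AJ : glued_ring J c a.

Lemma rV0_projective : projective ('rV[A]_0 : lmodType A).
Proof.
move=> N N' g f _; exists (\0 : {linear 'rV[A]_0 -> N}) => x.
by rewrite (_ : x = 0) ?linear0 //; apply/rowP => -[].
Qed.

(* cosyz N takes the place of N in double_cosyzygy_injective: contrary to N
   itself it is telescoping. *)
Lemma cosyz3_injective (N : lmodType A) : injective_module (iter 3 (@cosyz A) N).
Proof.
have tel (M : lmodType A) : telescoping (coinj_type M).
  exact: (telescoping_ahom p_pr Ap (lmod_exponent Ap (M := M))).
apply: (double_cosyzygy_injective p_pr Ap AJ (cosyz_exact (cosyz N))
  (cosyz_exact (cosyz (cosyz N)))) => //; try exact: (coinj_injective p_pr Ap).
by apply: telescoping_quotient (tel N); apply: quot_pi_surj.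
Qed.

Lemma projective_resolution3 (M : lmodType A) : has_resolution (@projective A) M 3.
Proof.
have cov (K : lmodType A) := short_exact_ker (free_cover_surj (M := K)).
apply: (has_resolutionS (cov _)); first exact: free_projective.
apply: (has_resolutionS (cov _)); first exact: free_projective.
apply: (has_resolutionS (cov _)); first exact: free_projective.
apply: has_resolution0; first exact: rV0_projective.
apply: (projective_ext_zero p_pr Ap) => N.
(* Three shifts turn Ext^1 of the third syzygy into Ext^4(M, N), which vanishes since the third
   cosyzygy of N is injective. *)
rewrite (ext_zero_shift p_pr Ap 0 N (cov _)); last exact: free_projective.
rewrite (ext_zero_shift p_pr Ap 1 N (cov _)); last exact: free_projective.
rewrite (ext_zero_shift p_pr Ap 2 N (cov _)); last exact: free_projective.
by apply: ext_zero_injective; apply: cosyz3_injective.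
Qed.

Lemma flat_resolution2 (M : lmodType A) : has_resolution (@flat A) M 2.
Proof.
have cov (K : lmodType A) := short_exact_ker (free_cover_surj (M := K)).
have free_flat S : flat (free_module A S).
  by apply: (projective_flat p_pr Ap); apply: free_projective.
apply: (has_resolutionS (cov _)); first exact: free_flat.
apply: (has_resolutionS (cov _)); first exact: free_flat.
apply: has_resolution0; first exact/(projective_flat p_pr Ap)/rV0_projective.
apply: (dual_injective_flat p_pr Ap).
(* Dualizing two free covers makes the dual of the second syzygy a second cosyzygy of the dual of M.
   Duals are telescoping, so no further shift is needed. *)
apply: (double_cosyzygy_injective p_pr Ap AJ
  (dual_short_exact p_pr Ap (cov _)) (dual_short_exact p_pr Ap (cov _))).
- exact: (flat_dual_injective p_pr Ap).
- exact: (flat_dual_injective p_pr Ap).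
- exact: (telescoping_ahom p_pr Ap (Fp_exponent p_pr)).
- exact: (telescoping_ahom p_pr Ap (Fp_exponent p_pr)).
Qed.

(* For the nodal cubic, x and y = t x are the coordinates; x u + y v = 0 means
   u = - t v, and t takes opposite values at the two glued points. *)
Variables (x y : A).
Hypotheses (x_reg : forall b, x * b = 0 -> b = 0).
Hypotheses (xyJ : forall u v, x * u + y * v = 0 -> J u /\ J v).
Hypotheses (xyc : forall n, exists u, x * u + y * c n = 0).
Hypotheses (J1 : ~ J 1) (Ja : forall n, J (a n)).

(** * Lower bounds: the module A / (x, y) and its syzygies *)

Lemma xy_lin : linear (fun u : A^o * A^o => x * u.1 + y * u.2 : A^o).
Proof.
move=> b u v; change (x * (b * u.1 + v.1) + y * (b * u.2 + v.2)
  = b * (x * u.1 + y * u.2) + (x * v.1 + y * v.2)).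
by rewrite !mulrDr addrACA !mulrA ![_ * b]mulrC.
Qed.

Definition xy_map : {linear (A^o * A^o)%type -> A^o} := mk_linear xy_lin.

Lemma xy_image0 : exists u, xy_map u = 0.
Proof. by exists 0; rewrite linear0. Qed.

Lemma xy_imageP b u v : (exists k, xy_map k = u) -> (exists k, xy_map k = v) ->
  exists k, xy_map k = b *: u + v.
Proof. by move=> [k <-] [l <-]; exists (b *: k + l); rewrite linearP. Qed.

Definition xy_ideal : submodule (A^o : lmodType A) :=
  @Submodule A A^o (fun b => exists k, xy_map k = b) xy_image0 xy_imageP.

Definition xy_quot : lmodType A := quot_module xy_ideal.

Definition xy_pi : {linear A^o -> xy_quot} := quot_pi xy_ideal.

Lemma xy_exact : exact_at xy_map xy_pi.
Proof. by move=> z; apply: quot_pi0. Qed.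

Definition syz : lmodType A := ker_type xy_map.

Lemma syz_rel (l : syz) : x * (ker_inj _ l).1 + y * (ker_inj _ l).2 = 0.
Proof. exact: submodule_in l. Qed.

(* Ext^3(A / (x, y), N) = Ext^1(J, N) is the obstruction to solving
   w_n - a_n w_(n+1) = e_n in N; a free N with basis (e_n) has no solution. *)
Lemma no_projective_resolution2 : ~ has_resolution (@projective A) xy_quot 2.
Proof.
move=> [P [d [e [P_proj P0 e_surj de dd]]]].
have [ca JE _ _] := AJ; have [cE c_reg] := ca.
have d1_inj : injective (d 1%N).
  move=> u v uv; apply/eqP; rewrite -subr_eq0; apply/eqP.
  have /dd[w <-] : d 1%N (u - v) = 0 by rewrite linearB uv subrr.
  by rewrite (P0 3 _ w) ?linear0.
pose N : lmodType A := free_module A nat.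
(* Ext^1([syz], N) and Ext^1(P 2, N) both equal Ext^3(A / (x, y), N), and P 2 is projective. *)
have : ext_zero 0 syz N.
  apply/(ext_zero_shift2 p_pr Ap 0 N (@submodule_inj_inj _ _ _)
    (exact_ker xy_map) xy_exact (quot_pi_surj (S := _))).
  - exact: regular2_projective.
  - exact: regular_projective.
  apply/(ext_zero_shift2 p_pr Ap 0 N d1_inj (dd 0%N) de e_surj) => //.
  exact: ext_zero_projective_mod.
move=> lift.
have tel : telescoping (coinj_type N).
  exact: (telescoping_ahom p_pr Ap (lmod_exponent Ap (M := N))).
(* The system is solvable in the coinduced module. Modulo N its solution is a compatible sequence,
   hence a map on J, which the vanishing of Ext^1 lifts back. *)
have [z zE] := tel a (fun n => coinj N (fs_delta n 1)).
have [coinj_i pi_s coinj_e] := cosyz_exact N.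
have piz n : cosyz_pi N (z n) = a n *: cosyz_pi N (z n.+1).
  apply/eqP; rewrite -subr_eq0 -linearZ -linearB zE; apply/eqP/coinj_e.
  by exists (fs_delta n 1).
have [g [gE g_lin]] := chain_map ca piz.
have f_lin : linear (fun l : syz => g (ker_inj xy_map l).2).
  move=> b l l'; rewrite linearP /=.
  by apply: g_lin; apply/JE; apply: (xyJ (syz_rel _)).2.
have [h hE] := lift (mk_linear f_lin).
pose t n := sval (cid (xyc n)).
have tP n : x * t n + y * c n = 0 by rewrite /t; case: cid.
pose l n : syz := submodule_elt (S := kernel xy_map) (v := (t n, c n)) (tP n).
have lE n : l n = a n *: l n.+1.
  apply: val_inj; apply: injective_projections => /=; last exact: cE.
  change (t n = a n * t n.+1).
  apply/eqP; rewrite -subr_eq0; apply/eqP/x_reg.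
  rewrite mulrBr mulrCA -[x * t n](addrK (y * c n)) tP.
  rewrite -[x * t n.+1](addrK (y * c n.+1)) tP cE !sub0r mulrN opprK.
  by rewrite mulrCA addrC subrr.
have wP n : exists w, coinj N w = z n - h (l n).
  apply/coinj_e; rewrite linearB hE /= -[c n]mul1r gE scale1r.
  exact: subrr.
(* The correction by h (l n) brings z n into N without disturbing the equations, because l n = a_n l
   (n+1). *)
pose w n : N := sval (cid (wP n)).
have wE n : coinj N (w n) = z n - h (l n) by rewrite /w; case: cid.
have wd n : w n - a n *: w n.+1 = fs_delta n 1.
  have jw : coinj N (a n *: w n.+1) = a n *: coinj N (w n.+1) by rewrite linearZ.
  have hl : h (l n) = a n *: h (l n.+1) by rewrite lE linearZ.
  apply: coinj_i; rewrite linearB jw !wE -zE scalerBr -hl.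
  by rewrite opprB addrA subrK.
pose W n m : A := fs_fun (w n) m.
have WE n m : W n m - a n * W n.+1 m = (m == n)%:R.
  have := congr1 (fun s => fs_fun s m) (wd n).
  by rewrite fs_deltaE => E; apply: etrans E _; case: eqP.
(* For m off the support of w 0, the homogeneous equations propagate the zero up to W m m, a_n being
   regular. The equation at n = m then makes a_m a unit, although it lies in J. *)
have [m Wm] : exists m, W 0%N m = 0.
  have [s sP] := submodule_in (w 0%N).
  exists (\max_(i <- s) i).+1; apply: sP; apply/negP => ms.
  by have := @leq_bigmax_seq _ s xpredT id _ ms isT; rewrite ltnn.
have Wn n : (n <= m)%N -> W n m = 0.
  elim: n => [//|n IHn nm]; have := WE n m.
  rewrite IHn ?(ltnW nm) // sub0r gtn_eqF // => /eqP; rewrite oppr_eq0 => /eqP aW.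
  by apply: (c_reg n); rewrite cE mulrA [_ * a n]mulrC aW mul0r.
have E : - W m.+1 m * a m = 1.
  by have := WE m m; rewrite Wn // eqxx sub0r -mulNr mulrC mulNr mulrN.
apply: J1; rewrite -E; exact: (submoduleZ (S := J) (- W m.+1 m) (Ja m)).
Qed.

Lemma koszul_in : xy_map (y, - x) = 0.
Proof. by change (x * y + y * - x = 0); rewrite mulrN mulrC subrr. Qed.

Definition koszul : syz := submodule_elt (S := kernel xy_map) koszul_in.

Lemma xy_syz0 : exists l l' : syz, 0 = x *: l + y *: l'.
Proof. by exists 0, 0; rewrite !scaler0 addr0. Qed.

Lemma xy_syzP b (u v : syz) : (exists l l', u = x *: l + y *: l') ->
  (exists l l', v = x *: l + y *: l') -> exists l l', b *: u + v = x *: l + y *: l'.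
Proof.
move=> [l [l' ->]] [k [k' ->]]; exists (b *: l + k), (b *: l' + k').
by rewrite !scalerDr !scalerA addrACA ![_ * b]mulrC.
Qed.

Definition xy_syz : submodule syz := Submodule xy_syz0 xy_syzP.

(** Suppose (y, - x) = x l + y l'. Its second coordinate and the relation satisfied by l' give x (1
    + l_2 - l'_1) = 0, so 1 = l'_1 - l_2 lies in J. *)
Lemma koszul_notin : ~ xy_syz koszul.
Proof.
move=> [l [l' ll']]; apply: J1.
have [u v] := xyJ (syz_rel l); have [u' v'] := xyJ (syz_rel l').
have /x_reg : x * (1 + (ker_inj _ l).2 - (ker_inj _ l').1) = 0.
  rewrite mulrBr mulrDr mulr1 -[x * _.1](addrK (y * (ker_inj _ l').2)) syz_rel.
  have E : (ker_inj _ koszul).2 = x * (ker_inj _ l).2 + y * (ker_inj _ l').2.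
    by rewrite ll' linearD !linearZ.
  by rewrite sub0r opprK -addrA -E; apply: subrr.
move/eqP; rewrite -addrA addr_eq0 => /eqP ->.
by rewrite opprB; apply: submoduleB.
Qed.

(* The Koszul relation (y, - x) is a nonzero element of the kernel
   Tor_2(A / (x, y), A / (x, y)) of syz / (x, y) syz -> (A / (x, y))^2. *)
Lemma no_flat_resolution1 : ~ has_resolution (@flat A) xy_quot 1.
Proof.
move=> [P [d [e [P_flat P0 e_surj de dd]]]].
have d0_inj : injective (d 0%N).
  move=> u v uv; apply/eqP; rewrite -subr_eq0; apply/eqP.
  have /dd[w <-] : d 0%N (u - v) = 0 by rewrite linearB uv subrr.
  by rewrite (P0 2%N _ w) ?linear0.
have dP := dual_short_exact p_pr Ap (And3 d0_inj e_surj de).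
have P_inj i := flat_dual_injective p_pr Ap (P_flat i).
have pi_ex := short_exact_ker (quot_pi_surj (S := xy_ideal)).
have [q iq] := short_exact_corestr (@submodule_inj_inj _ _ _)
  (exact_ker xy_map) xy_exact.
(* With M = A / (x, y), the dual of M has injective dimension at most 1, so Ext^1((x, y), [dual M])
   = Ext^2(M, [dual M]) = 0. *)
have ext : extends (dual p xy_quot) (ker_inj xy_map).
  apply: (lifts_extends iq dP (P_inj 0%N)).
  apply: (extends_lifts_sub (i := ker_inj xy_pi) dP).
    exact: regular_projective.
  by move=> f; apply: P_inj; case: pi_ex.
have [mu [muK mu0]] : exists mu : {additive syz -> 'F_p}, mu koszul <> 0 /\
    forall l l', mu (x *: l + y *: l') = 0.
  have [nu nuK] := separating_functional p_pr (v := quot_pi xy_syz koszul)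
    (lmod_exponent Ap (M := _)) (fun h => koszul_notin ((quot_pi0 _ _).1 h)).
  exists (nu \o quot_pi xy_syz); split=> // l l' /=.
  rewrite -[RHS](raddf0 nu); congr (nu _).
  by apply/quot_pi0; exists l, l'.
have fD (l : syz) : {morph (fun b : A^o => mu ((b : A) *: l)) : u v / u + v}.
  by move=> u v; rewrite scalerDl raddfD.
have f_lin : linear (fun l => mk_ahom (fD l)).
  move=> b l l'; apply: ahomP => k.
  change (mu (k *: (b *: l + l')) = mu ((b * k : A) *: l) + mu (k *: l')).
  by rewrite scalerDr raddfD scalerA [b * k]mulrC.
have pi_mono := ahom_map_inj (V := 'F_p) (quot_pi_surj (S := xy_ideal)).
(* The functional b |-> mu (b l) on A kills (x, y), so it is one on A / (x, y). *)
have [l|phi phiE] := factor_mono (k := mk_linear f_lin) pi_mono.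
  apply/(ahom_map_exact (V := 'F_p) (quot_pi_surj (S := _)) xy_exact).
  apply: ahomP => -[u v]; rewrite ahom_app0l ahom_mapE.
  change (mu ((x * u + y * v) *: l) = 0).
  by rewrite scalerDl -!scalerA mu0.
have [Psi PsiE] := ext phi.
apply: muK; rewrite -[koszul]scale1r.
have -> : mu (1 *: koszul) = ahom_app (phi koszul) (xy_pi 1).
  by have := congr1 (fun k => ahom_app k 1) (phiE koszul); rewrite ahom_mapE.
(* An extension of phi to A^2 forces this value at (y, - x); it vanishes because x and y annihilate
   A / (x, y), contradicting the choice of mu. *)
have -> : phi koszul = y *: Psi (1, 0) - x *: Psi (0, 1).
  rewrite -PsiE -!linearZ -linearB; congr (Psi _).
  by apply: injective_projections => /=;
    rewrite ?scaler0 ?subr0 ?sub0r [_ *: _]mulr1.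
have piI b : (exists k, xy_map k = b) -> xy_pi b = 0.
  by move=> hb; apply/quot_pi0.
rewrite ahom_appBl !ahom_appZ -!linearZ.
rewrite !piI ?ahom_app0 ?subr0 //.
  by exists (1, 0); change (x * 1 + y * 0 = x * 1); rewrite mulr0 addr0.
by exists (0, 1); change (x * 0 + y * 1 = y * 1); rewrite mulr0 add0r.
Qed.

Theorem glued_dimensions : gldim A = Some 3%N /\ wdim A = Some 2%N.
Proof.
have least_le (C : lmodType A -> Prop) M n k :
    has_resolution C M n -> least (has_resolution C M) = Some k -> (k <= n)%N.
  by move=> h /leastP[_]; apply.
have mono (C : lmodType A -> Prop) M n m : (n <= m)%N ->
    has_resolution C M n -> has_resolution C M m.
  move=> nm [P [d [e [CP P0 e_surj de dd]]]]; exists P, d, e; split=> // i mi.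
  exact/P0/(leq_ltn_trans nm).
have sup (C : lmodType A -> Prop) n M0 : (forall M, has_resolution C M n.+1) ->
    ~ has_resolution C M0 n ->
    sup_enat (fun M => least (has_resolution C M)) = Some n.+1.
  move=> Cn nM0; apply/leastP; split=> [M|m hm].
    rewrite /least; case: pselect => [exP|[]]; last by exists n.+1; apply/asboolP.
    by case: ex_minnP => k _; apply; apply/asboolP.
  rewrite ltnNge; apply/negP => mn; apply: nM0.
  have := hm M0; case E: (least _) => [k|] //= km.
  have /leastP[hk _] := E; apply: mono hk; exact: leq_trans km mn.
split; apply: sup; try exact: no_projective_resolution2.
- exact: projective_resolution3.
- exact: flat_resolution2.
- exact: no_flat_resolution1.
Qed.

End Bounds.

(** * The perfect closure of the nodal cubic *)

Section PerfectClosureLevels.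
Variables (R : comNzRingType) (p : nat) (charRp : p \in [pchar R]).
Local Notation Q := (perfect_closure charRp).

(* The image of the n-th copy of R in the colimit, i.e. the p^n-th root of a. *)
Definition proot (n : nat) (a : R) : Q := perf_class charRp (n, a).

Lemma proot_frob k n a : proot n a = proot (n + k) (frob charRp k a).
Proof.
by apply/perf_classP; exists 0%N; rewrite /= frob_add.
Qed.

Lemma frob_exp k a : frob charRp k a = a ^+ (p ^ k).
Proof. by elim: k => [|k IHk] //=; rewrite expnSr exprM -IHk. Qed.

Lemma prootS n a : proot n a = proot n.+1 (a ^+ p).
Proof. by rewrite (proot_frob 1) addn1. Qed.

Lemma prootD n : {morph proot n : a b / a + b}.
Proof.
move=> a b; rewrite [RHS](padd_pi charRp (n, a) (n, b)) (proot_frob n).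
by rewrite frobD.
Qed.

Lemma prootM n : {morph proot n : a b / a * b}.
Proof.
move=> a b; rewrite [RHS](pmul_pi charRp (n, a) (n, b)) (proot_frob n).
by rewrite frobM.
Qed.

Lemma proot0 n : proot n 0 = 0.
Proof. by apply: (@addrI _ (proot n 0)); rewrite -prootD !addr0. Qed.

Lemma prootN n : {morph proot n : a / - a}.
Proof.
by move=> a; apply: (@addrI _ (proot n a)); rewrite -prootD !subrr proot0.
Qed.

Lemma proot1 n : proot n 1 = 1.
Proof.
by apply/perf_classP; exists 0%N; rewrite /= !frob1.
Qed.

Lemma proot_nat n k : proot n k%:R = k%:R.
Proof.
elim: k => [|k IHk]; first exact: proot0.
by rewrite !mulrS prootD IHk proot1.
Qed.

Lemma prootX n a k : proot n (a ^+ k) = proot n a ^+ k.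
Proof.
elim: k => [|k IHk]; first exact: proot1.
by rewrite !exprS prootM IHk.
Qed.

Lemma prootW (x : Q) : exists n a, x = proot n a.
Proof. by elim/perfW: x => -[n a]; exists n, a. Qed.

Lemma prootW2 (x y : Q) : exists n a b, x = proot n a /\ y = proot n b.
Proof.
have [n [a ->]] := prootW x; have [m [b ->]] := prootW y.
exists (n + m)%N, (frob charRp m a), (frob charRp n b).
by rewrite -proot_frob addnC -proot_frob.
Qed.

Lemma perfect_pchar : p%:R = 0 :> Q.
Proof. by rewrite -(proot_nat 0) (pcharf0 charRp) proot0. Qed.

(** The Frobenius map of a reduced ring is injective, so every level embeds into the colimit. *)
Lemma proot_eq0 n a : (forall b : R, b ^+ p = 0 -> b = 0) ->
  proot n a = 0 -> a = 0.
Proof.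
move=> red; rewrite -(proot0 n) => /perf_classP[k /=].
rewrite frob0; elim: (k + n)%N => [|j IHj] //= h.
exact/IHj/red.
Qed.

End PerfectClosureLevels.

Section PerfectClosureMap.
Variables (R S : comNzRingType) (p : nat).
Variables (charRp : p \in [pchar R]) (charSp : p \in [pchar S]).
Variable f : {rmorphism R -> S}.

Definition perf_map (x : perfect_closure charRp) : perfect_closure charSp :=
  proot charSp (perf_pair x).1 (f (perf_pair x).2).

Lemma perf_map_proot n a : perf_map (proot charRp n a) = proot charSp n (f a).
Proof.
apply/perf_classP; have [k /= h] := perf_pairP charRp (n, a).
by exists k; move/(congr1 f): h; rewrite /= !frob_exp !rmorphXn.
Qed.

Lemma perf_map_is_zmod_morphism : zmod_morphism perf_map.
Proof.
move=> x y; have [n [a [b [-> ->]]]] := prootW2 x y.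
by rewrite -prootN -prootD !perf_map_proot rmorphB prootD prootN.
Qed.

Lemma perf_map_is_monoid_morphism : monoid_morphism perf_map.
Proof.
split=> [|x y]; first by rewrite -(proot1 _ 0) perf_map_proot rmorph1 proot1.
have [n [a [b [-> ->]]]] := prootW2 x y.
by rewrite -prootM !perf_map_proot rmorphM prootM.
Qed.

HB.instance Definition _ := GRing.isZmodMorphism.Build _ _ perf_map
  perf_map_is_zmod_morphism.
HB.instance Definition _ := GRing.isMonoidMorphism.Build _ _ perf_map
  perf_map_is_monoid_morphism.

End PerfectClosureMap.

(** * The perfect closure of F_p[t] *)

Section PerfectPolynomials.
Variables (p : nat) (p_pr : prime p) (p_odd : p <> 2%N).
Local Notation F := 'F_p.

Lemma Fp_2_neq0 : 2%:R != 0 :> F.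
Proof.
rewrite -(dvdn_pcharf (pchar_Fp p_pr)) dvdn_prime2 //.
exact/eqP.
Qed.

Lemma poly_pchar : p \in [pchar {poly F}].
Proof. by rewrite pchar_poly pchar_Fp. Qed.

Definition perfect_Fp := perfect_closure (pchar_Fp p_pr).
Definition perfect_poly := perfect_closure poly_pchar.
Local Notation PF := perfect_Fp.
Local Notation B := perfect_poly.

(** Evaluation comes by functoriality, hence with values in the perfect closure of F_p, which is
    still the prime field by [perfect_Fp_nat]. *)
Definition ev (u : F) : {rmorphism B -> PF} :=
  @perf_map _ _ p poly_pchar (pchar_Fp p_pr) (horner_eval u).

Lemma ev_proot u n f : ev u (proot poly_pchar n f) = proot _ n f.[u].
Proof. exact: perf_map_proot. Qed.

Lemma poly_reduced (f : {poly F}) : f ^+ p = 0 -> f = 0.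
Proof. by move/eqP; rewrite expf_eq0 => /andP[_ /eqP]. Qed.

Lemma Fp_reduced (u : F) : u ^+ p = 0 -> u = 0.
Proof. by move/eqP; rewrite expf_eq0 => /andP[_ /eqP]. Qed.

Lemma perfect_Fp_double (z : PF) : z + z = 0 -> z = 0.
Proof.
have [n [a ->]] := prootW z; rewrite -prootD => /(proot_eq0 Fp_reduced)/eqP.
rewrite -mulr2n -mulr_natr mulf_eq0 (negbTE Fp_2_neq0) orbF => /eqP ->.
exact: proot0.
Qed.

Lemma perfect_Fp_nat (z : PF) : exists k, z = k%:R.
Proof.
have [n [a ->]] := prootW z; exists (a : nat).
by rewrite -(proot_nat _ n) natr_Zp.
Qed.

Lemma perfect_poly_domain (u v : B) : u * v = 0 -> u = 0 \/ v = 0.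
Proof.
have [n [f [g [-> ->]]]] := prootW2 u v; rewrite -prootM.
move=> /(proot_eq0 poly_reduced)/eqP; rewrite mulf_eq0.
by case/orP=> /eqP ->; rewrite proot0; [left|right].
Qed.

(** Any two elements lie in a common copy of F_p[t], where Bezout's identity holds. *)
Lemma perfect_poly_bezout (u v : B) : exists g, [/\ exists k l, g = k * u + l * v,
  exists k, u = k * g & exists l, v = l * g].
Proof.
have [n [f [g [-> ->]]]] := prootW2 u v.
have [[k l] /= kl] := Bezoutp f g.
exists (proot _ n (k * f + l * g)); split.
- by exists (proot _ n k), (proot _ n l); rewrite -!prootM -prootD.
- have /dvdpP[q E] : k * f + l * g %| f by rewrite (eqp_dvdl _ kl) dvdp_gcdl.
  by exists (proot _ n q); rewrite -prootM -E.
- have /dvdpP[q E] : k * f + l * g %| g by rewrite (eqp_dvdl _ kl) dvdp_gcdr.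
  by exists (proot _ n q); rewrite -prootM -E.
Qed.

Definition t_poly : B := proot poly_pchar 0 'X.
Definition x_root n : B := proot poly_pchar n ('X^2 - 1).

Lemma ev_t_poly u : ev u t_poly = proot _ 0 u.
Proof. by rewrite ev_proot hornerX. Qed.

Lemma x_rootS n : x_root n = x_root n.+1 ^+ p.
Proof. by rewrite /x_root prootS prootX. Qed.

Lemma x_root_neq0 n : x_root n <> 0.
Proof.
move/(proot_eq0 poly_reduced)/eqP; rewrite subr_eq0 => /eqP X2.
by have := size_polyXn F 2; rewrite X2 size_poly1.
Qed.

Lemma ev1_x_root n : ev 1 (x_root n) = 0.
Proof. by rewrite ev_proot !hornerE expr1n subrr proot0. Qed.

Lemma evN1_x_root n : ev (-1) (x_root n) = 0.
Proof. by rewrite ev_proot !hornerE sqrrN expr1n subrr proot0. Qed.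

(** For p odd, t - 1 and t + 1 are coprime, so a polynomial with both roots is divisible by t^2 -
    1. *)
Lemma perfect_poly_vanish (b : B) : ev 1 b = 0 -> ev (-1) b = 0 ->
  exists n k, b = k * x_root n.
Proof.
have [n [f ->]] := prootW b; rewrite !ev_proot.
move=> /(proot_eq0 Fp_reduced) f1 /(proot_eq0 Fp_reduced) fN1.
have /dvdpP[g fE] : 'X^2 - 1 %| f.
  have -> : 'X^2 - 1 = ('X - 1%:P) * ('X - (-1)%:P) :> {poly F}.
    by rewrite polyCN opprK polyC1 -subr_sqr expr1n.
  rewrite Gauss_dvdp; first by rewrite !dvdp_XsubCl /root f1 fN1 eqxx.
  rewrite coprimep_XsubC /root !hornerE -opprD oppr_eq0.
  exact: Fp_2_neq0.
by exists n, (proot _ n g); rewrite -prootM -fE.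
Qed.

End PerfectPolynomials.

(** * Parametrization of the nodal cubic *)

Section NodalParametrization.
Variables (p : nat) (p_pr : prime p) (p_odd : p <> 2%N).
Local Notation F := 'F_p.
Local Notation h := (nodal_poly p).

(** The line y = t x through the node meets the cubic again where x = t^2 - 1. *)
Definition x_param : {poly F} := 'X^2 - 1.
Definition y_param : {poly F} := 'X * x_param.

Lemma size_x_param : size x_param = 3%N.
Proof. by rewrite size_polyDl ?size_polyXn // size_polyN size_poly1. Qed.

Definition param : {rmorphism {poly {poly F}} -> {poly F}} :=
  horner_eval y_param \o map_poly (comp_poly x_param).

Lemma paramX : param 'X = y_param.
Proof. by rewrite /= map_polyX /horner_eval hornerX. Qed.

Lemma paramC f : param f%:P = f \Po x_param.
Proof. by rewrite /= map_polyC /horner_eval hornerC. Qed.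

Lemma param_nodal : param h = 0.
Proof.
rewrite /nodal_poly rmorphB rmorphD !rmorphXn paramX paramC comp_polyX.
rewrite /y_param /x_param.
ring.
Qed.

Definition nodal_map (r : nodal_cubic p) : {poly F} :=
  param (val (r : {poly %/ h})).

Lemma nodal_map_in P : nodal_map (in_qpoly h P) = param P.
Proof.
have := congr1 param (Pdiv.RingMonic.rdivp_eq (nodal_poly_monic p) P).
rewrite rmorphD rmorphM param_nodal mulr0 add0r => ->.
by congr (param (Pdiv.CommonRing.rmodp _ _)); apply: mk_monic_nodal.
Qed.

Lemma in_qpoly_val (r : nodal_cubic p) : r = in_qpoly h (val (r : {poly %/ h})).
Proof. by apply/val_inj/esym/in_qpoly_small/size_mk_monic. Qed.

Lemma nodal_map_is_zmod_morphism : zmod_morphism nodal_map.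
Proof. by move=> r s; rewrite /nodal_map -rmorphB. Qed.

Lemma nodal_map_is_monoid_morphism : monoid_morphism nodal_map.
Proof.
split=> [|r s]; first exact: (rmorph1 param).
rewrite (in_qpoly_val r) (in_qpoly_val s) -rmorphM !nodal_map_in.
exact: rmorphM.
Qed.

HB.instance Definition _ := GRing.isZmodMorphism.Build _ _ nodal_map
  nodal_map_is_zmod_morphism.
HB.instance Definition _ := GRing.isMonoidMorphism.Build _ _ nodal_map
  nodal_map_is_monoid_morphism.

Lemma param2 (f g : {poly F}) :
  param (f%:P + g%:P * 'X) = f \Po x_param + (g \Po x_param) * y_param.
Proof.
by rewrite rmorphD rmorphM !paramC paramX.
Qed.

(** A reduced representative f(x) + g(x) y becomes U + V y with U and V even and y odd in t.
    Substituting - t for t gives U - V y = 0 too, whence 2 U = 0. *)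
Lemma nodal_map_inj r : nodal_map r = 0 -> r = 0.
Proof.
rewrite /nodal_map; set P : {poly {poly F}} := val _ => P0.
have Psize : (size P <= 2)%N.
  have E : size (mk_monic h) = 3%N by rewrite mk_monic_nodal nodal_poly_size.
  by rewrite -ltnS -E; apply: size_mk_monic.
have PE : P = (P`_0)%:P + (P`_1)%:P * 'X.
  apply/polyP => -[|[|i]]; rewrite coefD coefMX !coefC /= ?addr0 ?add0r //.
  by rewrite nth_default ?(leq_trans Psize).
move: P0; rewrite PE param2; set U := _ \Po _; set V := _ \Po _ => UV.
have xtN : x_param \Po (- 'X) = x_param.
  by rewrite /x_param comp_polyB comp_polyC rmorphXn /= comp_polyX sqrrN.
have UV' : U - V * y_param = 0.
  rewrite -[RHS](comp_poly0 (- 'X)) -UV comp_polyD !comp_polyM comp_polyX.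
  by rewrite -!comp_polyA xtN mulNr mulrN.
have U0 : U = 0.
  have : 2%:R *: U = 0.
    by rewrite scaler_nat mulr2n -{2}(subrK (V * y_param) U) UV' add0r UV.
  by move/eqP; rewrite scaler_eq0 (negbTE (Fp_2_neq0 p_pr p_odd)) => /eqP.
have V0 : V = 0.
  move/eqP: UV; rewrite U0 add0r !mulf_eq0 polyX_eq0 /= -(size_poly_eq0 x_param).
  by rewrite size_x_param orbF => /eqP.
have Psmall i : P`_i \Po x_param = 0 -> P`_i = 0.
  by move/eqP; rewrite comp_poly_eq0 ?size_x_param // => /eqP.
apply: val_inj; change (P = 0); rewrite PE.
by rewrite (Psmall 0%N U0) (Psmall 1%N V0) mul0r addr0.
Qed.

(** Both t = 1 and t = -1 go to the node x = y = 0, so both values are P(0, 0). *)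
Lemma nodal_map_eval r : (nodal_map r).[1] = (nodal_map r).[-1].
Proof.
rewrite /nodal_map; set P : {poly {poly F}} := val _.
have {}Pev u : u ^+ 2 = 1 -> (param P).[u] = (map_poly (horner_eval 0) P).[0].
  move=> u2; have xu : x_param.[u] = 0 by rewrite !hornerE u2 subrr.
  have yu : y_param.[u] = 0 by rewrite hornerM xu mulr0.
  elim/poly_ind: P => [|P f IHP]; first by rewrite !rmorph0 !hornerE.
  rewrite rmorphD rmorphM paramC paramX hornerD hornerM yu mulr0 add0r.
  by rewrite rmorphD rmorphM /= map_polyX map_polyC !hornerE horner_comp xu.
by rewrite !Pev ?sqrrN ?expr1n.
Qed.

(** Write g = E(t^2) + O(t^2) t. Equal values at 1 and -1 force 2 O(1) = 0, so O(s) = Q(s) (s - 1)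
    and O(t^2) t = Q(x + 1) y, while t^2 = x + 1. *)
Lemma nodal_map_surj (g : {poly F}) : g.[1] = g.[-1] -> exists r, nodal_map r = g.
Proof.
move=> gE; set E := even_poly g; set O := odd_poly g.
have gEO : g = (E \Po 'X^2) + (O \Po 'X^2) * 'X by rewrite poly_even_odd.
have O1 : O.[1] = 0.
  move: gE; rewrite gEO !(hornerE, horner_comp) sqrrN !expr1n => /addrI/eqP.
  rewrite mulrN mulr1 -subr_eq0 opprK -mulr2n -mulr_natr mulf_eq0.
  by rewrite (negbTE (Fp_2_neq0 p_pr p_odd)) orbF => /eqP.
have /factor_theorem[Q OE] : root O 1 by apply/eqP.
have xt1 : ('X + 1) \Po x_param = 'X^2.
  by rewrite comp_polyD comp_polyX comp_polyC /x_param subrK.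
exists (in_qpoly h ((E \Po ('X + 1))%:P + (Q \Po ('X + 1))%:P * 'X)).
rewrite nodal_map_in param2 -!comp_polyA xt1 gEO OE; congr (_ + _).
rewrite comp_polyM comp_polyB comp_polyX comp_polyC /y_param /x_param -polyC1.
by rewrite mulrA mulrAC.
Qed.

End NodalParametrization.

(** * The perfect closure of the cubic as a glued ring *)

Section Gluing.
Variables (p : nat) (p_pr : prime p) (p_odd : p <> 2%N).
Local Notation F := 'F_p.
Local Notation A := (perfect_closure (nodal_pchar p_pr)).
Local Notation B := (perfect_poly p_pr).
Local Notation ev := (ev p_pr).
Local Notation x_root := (x_root p_pr).
Local Notation t_poly := (t_poly p_pr).

Definition normalization : {rmorphism A -> B} :=
  @perf_map _ _ p (nodal_pchar p_pr) (poly_pchar p_pr) (@nodal_map p).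
Local Notation io := normalization.

Lemma normalization_proot n r :
  io (proot (nodal_pchar p_pr) n r) = proot (poly_pchar p_pr) n (nodal_map r).
Proof. exact: perf_map_proot. Qed.

Lemma normalization_inj0 a : io a = 0 -> a = 0.
Proof.
have [n [r ->]] := prootW a; rewrite normalization_proot.
move=> /(proot_eq0 (@poly_reduced p))/(nodal_map_inj p_pr p_odd) ->.
exact: proot0.
Qed.

Lemma normalization_inj : injective io.
Proof.
move=> a b ab; apply/eqP; rewrite -subr_eq0; apply/eqP/normalization_inj0.
by rewrite rmorphB ab subrr.
Qed.

Lemma ev_normalization a : ev 1 (io a) = ev (-1) (io a).
Proof.
have [n [r ->]] := prootW a; rewrite normalization_proot !ev_proot.
by rewrite nodal_map_eval.
Qed.

Lemma normalization_surj b : ev 1 b = ev (-1) b -> exists a, io a = b.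
Proof.
have [n [f ->]] := prootW b; rewrite !ev_proot => /eqP.
rewrite -subr_eq0 -prootN -prootD => /eqP/(proot_eq0 (@Fp_reduced p))/eqP.
rewrite subr_eq0 => /eqP/(nodal_map_surj p_pr p_odd)[r <-].
by exists (proot _ n r); rewrite normalization_proot.
Qed.

(** J as an ideal of B. Since it lies in the image of A, multiplying by its elements is how elements
    of B are brought into A. *)
Definition vanishing (b : B) : Prop := ev 1 b = 0 /\ ev (-1) b = 0.

Lemma vanishing_normalization b : vanishing b -> exists a, io a = b.
Proof. by move=> [b1 bN1]; apply: normalization_surj; rewrite b1 bN1. Qed.

Lemma vanishingMl b k : vanishing b -> vanishing (k * b).
Proof. by move=> [b1 bN1]; split; rewrite rmorphM ?b1 ?bN1 mulr0. Qed.

Lemma vanishingMr b k : vanishing b -> vanishing (b * k).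
Proof. by rewrite mulrC; apply: vanishingMl. Qed.

Lemma vanishing_x_root n : vanishing (x_root n).
Proof. by split; [apply: ev1_x_root|apply: evN1_x_root]. Qed.

Definition x_ratio n : B := x_root n.+1 ^+ p.-1.

Lemma x_ratioE n : x_root n = x_ratio n * x_root n.+1.
Proof. by rewrite x_rootS /x_ratio -exprSr prednK ?prime_gt0. Qed.

(** As p - 1 >= 1, a factor c_(n+1) is left in the ratio. *)
Lemma vanishing_x_ratio n : vanishing (x_ratio n).
Proof.
have -> : x_ratio n = x_root n.+1 ^+ p.-2 * x_root n.+1.
  by rewrite /x_ratio -exprSr prednK // -subn1 subn_gt0 prime_gt1.
exact/vanishingMl/vanishing_x_root.
Qed.

Lemma x_root_up n m : exists k, x_root n = k * x_root (n + m)%N.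
Proof.
elim: m => [|m [k kE]]; first by exists 1; rewrite addn0 mul1r.
by exists (k * x_ratio (n + m)%N); rewrite addnS -mulrA -x_ratioE.
Qed.

Definition norm_preimage (b : B) (hb : vanishing b) : A :=
  sval (cid (vanishing_normalization hb)).

Lemma norm_preimageE b (hb : vanishing b) : io (norm_preimage hb) = b.
Proof. by rewrite /norm_preimage; case: cid. Qed.

Definition node_gen n : A := norm_preimage (vanishing_x_root n).
Definition node_ratio n : A := norm_preimage (vanishing_x_ratio n).

Lemma node_chain : chain node_gen node_ratio.
Proof.
split=> [n|n b hb].
  by apply: normalization_inj; rewrite rmorphM !norm_preimageE x_ratioE.
apply: normalization_inj0; have /(congr1 io) := hb.
rewrite rmorphM norm_preimageE rmorph0.
by case/perfect_poly_domain => // /x_root_neq0.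
Qed.

Lemma node_ideal0 : vanishing (io 0).
Proof. by rewrite rmorph0; split; rewrite rmorph0. Qed.

Lemma node_ideal_closed (a : A) (u v : A^o) :
  vanishing (io u) -> vanishing (io v) -> vanishing (io (a *: u + v)).
Proof.
move=> [u1 u2] [v1 v2]; have -> : io (a *: u + v) = io a * io u + io v.
  by rewrite rmorphD; congr (_ + _); apply: rmorphM.
by split; rewrite rmorphD rmorphM ?u1 ?u2 ?v1 ?v2 mulr0 addr0.
Qed.

Definition node_ideal : submodule (A^o : lmodType A) :=
  @Submodule A A^o (fun a => vanishing (io a)) node_ideal0 node_ideal_closed.

(** The cofactor k of c_n lies in B only. Passing to c_(n+1) multiplies it by a ratio in J, which
    puts it into A. *)
Lemma node_idealE b : node_ideal b <-> exists n d, b = d * node_gen n.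
Proof.
split=> [[b1 b2]|[n [d ->]]]; last first.
  change (vanishing (io (d * node_gen n))); rewrite rmorphM norm_preimageE.
  exact/vanishingMl/vanishing_x_root.
have [n [k kE]] := perfect_poly_vanish p_odd b1 b2.
have [d dE] := vanishing_normalization (vanishingMl k (vanishing_x_ratio n)).
exists n.+1, d; apply: normalization_inj.
by rewrite rmorphM norm_preimageE dE kE -mulrA -x_ratioE.
Qed.

Lemma node_residue (b : A) : exists k, node_ideal (b - k%:R).
Proof.
have [k kE] := perfect_Fp_nat (ev 1 (io b)); exists k.
split; rewrite rmorphB rmorph_nat rmorphB rmorph_nat -?ev_normalization kE;
exact: subrr.
Qed.

Lemma A_enum : exists s : nat -> A, forall a, exists n, s n = a.
Proof.
pose s n : A := if unpickle n is Some x
  then proot _ (x : nat * {poly {poly F}}).1 (in_qpoly (nodal_poly p) x.2) else 0.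
exists s => a; have [n [r ->]] := prootW a.
exists (pickle (n, val (r : {poly %/ nodal_poly p}))).
by rewrite /s pickleK /= -in_qpoly_val.
Qed.

Section IdealChain.
Variables (I : submodule (A^o : lmodType A)) (i0 : A).
Hypotheses (Ii0 : I i0) (i0_neq0 : i0 <> 0).
Variable s : nat -> A.
Hypothesis s_surj : forall a, exists n, s n = a.

(** An enumeration of I, where i0 stands in for the elements of A outside I. *)
Definition ideal_gen n : A := if pselect (I (s n)) then s n else i0.

Lemma ideal_gen_in n : I (ideal_gen n).
Proof. by rewrite /ideal_gen; case: pselect. Qed.

Definition bgcd (u v : B) : B := sval (cid (perfect_poly_bezout u v)).

(** Greatest common divisors in B of longer and longer lists of elements of I; starting from i0 <> 0
    keeps them nonzero. *)
Fixpoint gcd_gen n : B :=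
  if n is m.+1 then bgcd (gcd_gen m) (io (ideal_gen m)) else io i0.

Lemma gcd_genP n :
  [/\ exists k l, gcd_gen n.+1 = k * gcd_gen n + l * io (ideal_gen n),
  exists k, gcd_gen n = k * gcd_gen n.+1
  & exists l, io (ideal_gen n) = l * gcd_gen n.+1].
Proof. by rewrite /= /bgcd; case: cid. Qed.

Lemma gcd_gen_neq0 n : gcd_gen n <> 0.
Proof.
elim: n => [|n IHn]; first by move/normalization_inj0.
by have [_ [k kE] _] := gcd_genP n => h; apply: IHn; rewrite kE h mulr0.
Qed.

(** The gcd is a combination of elements of I with coefficients in B; multiplication by j moves
    these coefficients into J, hence into A. *)
Lemma gcd_gen_in n j : vanishing j -> exists2 a, I a & io a = j * gcd_gen n.
Proof.
elim: n j => [|n IHn] j hj.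
  have [m mE] := vanishing_normalization hj.
  exists (m * i0); last by rewrite rmorphM mE.
  exact: (submoduleZ (S := I) m Ii0).
have [[k [l ->]] _ _] := gcd_genP n.
have [a Ia aE] := IHn _ (vanishingMr k hj).
have [m mE] := vanishing_normalization (vanishingMr l hj).
exists (a + m * ideal_gen n); last by rewrite rmorphD rmorphM aE mE mulrDr !mulrA.
apply: submoduleD => //.
exact: (submoduleZ (S := I) m (ideal_gen_in n)).
Qed.

Definition quo_gen n : B := let: And3 _ e _ := gcd_genP n in sval (cid e).

Lemma quo_genE n : gcd_gen n = quo_gen n * gcd_gen n.+1.
Proof. by rewrite /quo_gen; case: gcd_genP => _ e _; case: cid. Qed.

Lemma gcd_gen_up n m : exists k, gcd_gen n = k * gcd_gen (n + m)%N.
Proof.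
elim: m => [|m [k kE]]; first by exists 1; rewrite addn0 mul1r.
by exists (k * quo_gen (n + m)%N); rewrite addnS -mulrA -quo_genE.
Qed.

Lemma ideal_chain : exists d a' : nat -> A, [/\ chain d a', forall n, I (d n)
  & forall i j, I i -> node_ideal j -> exists n b, j * i = b * d n].
Proof.
have dP n := gcd_gen_in n (vanishing_x_root n).
pose d n := s2val (cid2 (dP n)).
have dI n : I (d n) by rewrite /d; case: cid2.
(* The gcd itself need not come from A; the factor c_n puts it into I, and varying n with it makes
   the ratios lie in J. *)
have dE n : io (d n) = x_root n * gcd_gen n by rewrite /d; case: cid2.
pose a' n := norm_preimage (vanishingMl (quo_gen n) (vanishing_x_ratio n)).
exists d, a'; split=> //.
  split=> [n|n b hb].
    apply: normalization_inj; rewrite rmorphM !dE norm_preimageE quo_genE x_ratioE.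
    by rewrite mulrACA [x_ratio n * _]mulrC.
  apply: normalization_inj0; have /(congr1 io) := hb; rewrite rmorphM dE rmorph0.
  by do 2![case/perfect_poly_domain => //]; [move/x_root_neq0|move/gcd_gen_neq0].
move=> i j Ii /node_idealE[m [b ->]].
have [k kE] := s_surj i; have genE : ideal_gen k = i.
  by rewrite /ideal_gen kE; case: pselect.
have [_ _ [l lE]] := gcd_genP k; rewrite genE in lE.
(* The index m + 1 splits off the ratio c_m / c_(m+1), whose membership in J brings the remaining
   cofactor from B into A. *)
have [q qE] := gcd_gen_up k.+1 m.+1; have [r rE] := x_root_up m.+1 k.+1.
rewrite [(k.+1 + _)%N]addnC in qE.
have [e eE] := vanishing_normalization
  (vanishingMl (io b * (r * (l * q))) (vanishing_x_ratio m)).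
exists (m.+1 + k.+1)%N, e; apply: normalization_inj.
rewrite !rmorphM eE dE norm_preimageE x_ratioE lE qE {1}rE.
set X := x_root _; set Y := gcd_gen _; set Z := x_ratio m; set W := io b.
ring.
Qed.

End IdealChain.

Lemma nodal_glued : glued_ring node_ideal node_gen node_ratio.
Proof.
split; [exact: node_chain|exact: node_idealE|exact: node_residue|].
move=> I [i0 Ii0 i0_neq0]; have [s s_surj] := A_enum.
exact: (ideal_chain Ii0 i0_neq0 s_surj).
Qed.

Lemma nodal_relation : exists x y : A,
  [/\ forall b, x * b = 0 -> b = 0,
      forall u v, x * u + y * v = 0 -> node_ideal u /\ node_ideal v,
      forall n, exists u, x * u + y * node_gen n = 0, ~ node_ideal 1
    & forall n, node_ideal (node_ratio n)].
Proof.
have [x xE] := vanishing_normalization (vanishing_x_root 0).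
have [y yE] := vanishing_normalization (vanishingMl t_poly (vanishing_x_root 0)).
exists x, y.
have ioE u v : io (x * u + y * v) = x_root 0 * (io u + t_poly * io v).
  by rewrite rmorphD !rmorphM xE yE mulrDr mulrA [t_poly * _]mulrC.
have iot u v : x * u + y * v = 0 -> io u = - (t_poly * io v).
  move/(congr1 io); rewrite ioE rmorph0.
  move=> /perfect_poly_domain[/x_root_neq0 //|/eqP].
  by rewrite addr_eq0 => /eqP.
have ev1t : ev 1 t_poly = 1 by rewrite ev_t_poly proot1.
have evN1t : ev (-1) t_poly = -1 by rewrite ev_t_poly prootN proot1.
split=> [b|u v /iot uE|n||n].
- move/(congr1 io); rewrite rmorphM xE rmorph0.
  move=> /perfect_poly_domain[/x_root_neq0 //|].
  exact: normalization_inj0.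
(* The values of u = - t v at 1 and -1 are - v(1) and v(-1) = v(1); u takes equal values there, so 2
   v(1) = 0. *)
- have v1 : ev 1 (io v) = 0.
    apply: (perfect_Fp_double p_odd); have := ev_normalization u; rewrite uE.
    rewrite !rmorphN !rmorphM ev1t evN1t -ev_normalization mul1r mulN1r opprK.
    move=> {2}<-.
    exact: subrr.
  have Jv : vanishing (io v) by split; rewrite // -ev_normalization.
  split; last exact: Jv.
  by change (vanishing (io u)); rewrite uE -mulNr; apply: vanishingMl.
- have [u uE] := vanishing_normalization
    (vanishingMl (- t_poly) (vanishing_x_root n)).
  exists u; apply: normalization_inj0.
  by rewrite [LHS]ioE norm_preimageE [io u]uE mulNr addNr mulr0.
- by move=> [/eqP]; rewrite !rmorph1 oner_eq0.
- change (vanishing (io (node_ratio n))); rewrite norm_preimageE.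
  exact: vanishing_x_ratio.
Qed.

End Gluing.

Local Close Scope ring_scope.

Theorem lemma7p1 (p : nat) (p_pr : prime p) (p_neq2 : p <> 2) :
  gldim (perfect_closure (nodal_pchar p_pr)) = Some 3
  /\ wdim (perfect_closure (nodal_pchar p_pr)) = Some 2.
Proof.
have [x [y [x_reg xyJ xyc J1 Ja]]] := nodal_relation p_pr p_neq2.
exact: (glued_dimensions p_pr (perfect_pchar _) (nodal_glued p_pr p_neq2)
  x_reg xyJ xyc J1 Ja).
Qed.
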